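(* Let $D$ be a diagram of a knot $K$, and equip $K$ with the blackboard framing determined by $D$. Then the self-linking number of the resulting framed knot is equal to the writhe of the diagram $D$.
   Context: A framed knot $(K,V)$ in $S^3$ is a knot $K$ with a continuous nonvanishing vector field $V$ normal to $K$ (a framing). Its self-linking number is $lk(K,K')$, where $K$ is given an orientation and $K'$ is the knot formed by a small shift of $K$ in the direction of the framing vector field, oriented parallel to $K$; it does not depend on the orientation of $K$. Here, for disjoint oriented knots, $lk$ is one half of the sum of the signs of the crossings between the two knots in a link diagram (self-crossings are not counted). The blackboard framing of a plane knot projection is given by a nonzero vector field normal to the knot that is everywhere parallel to the projection plane. The writhe of a knot diagram is the sum of the signs of all its crossings (independent of the orientation of the knot). *)

(* Defs.v *)
From HB Require Import structures.
From mathcomp Require Import all_boot all_order all_algebra.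
From mathcomp Require Import all_classical all_reals all_analysis.

Set Implicit Arguments.
Unset Strict Implicit.
Unset Printing Implicit Defensive.

Import Order.TTheory GRing.Theory Num.Theory.
Import numFieldNormedType.Exports.

Local Open Scope classical_set_scope.
Local Open Scope ring_scope.

(* Knots live in R^3, i.e. S^3 minus a point, and the plane of projection is
   the xy-plane, seen from z = +oo.  An oriented closed curve is a 1-periodic
   function of the real line. *)
Definition xcoord (R : realType) (v : 'rV[R]_3) : R := v 0 (inord 0).
Definition ycoord (R : realType) (v : 'rV[R]_3) : R := v 0 (inord 1).
Definition height (R : realType) (v : 'rV[R]_3) : R := v 0 (inord 2).

Definition proj (R : realType) (v : 'rV[R]_3) : R * R := (xcoord v, ycoord v).

Definition dot (R : realType) (u v : 'rV[R]_3) : R := \sum_(i < 3) u 0 i * v 0 i.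

Definition planar_det (R : realType) (u v : 'rV[R]_3) : R :=
  xcoord u * ycoord v - ycoord u * xcoord v.

Definition smooth (R : realType) (f : R -> 'rV[R]_3) : Prop :=
  forall (n : nat) (t : R), derivable (derive1n n f) t 1.

Definition closed_curve (R : realType) (f : R -> 'rV[R]_3) : Prop :=
  forall t : R, f (t + 1) = f t.

Record is_knot (R : realType) (K : R -> 'rV[R]_3) : Prop := IsKnot {
  knot_closed : closed_curve K;
  knot_smooth : smooth K;
  knot_regular : forall t : R, derive1 K t != 0;
  knot_inj : forall s t : R, K s = K t -> s - t \is a Num.int }.

(* The components of a link are indexed by an arbitrary type I. *)
Definition is_link (R : realType) (I : Type) (L : I -> R -> 'rV[R]_3) : Prop :=
  (forall i : I, is_knot (L i)) /\
  (forall (i j : I) (s t : R), i <> j -> L i s <> L j t).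

(* Crossings, as pairs of parameters in [0, 1), at which the first curve passes
   over the second one.  Since heights differ strictly, crossings K K lists
   every self-crossing of a knot K exactly once, with the overpass first. *)
Definition crossings (R : realType) (K1 K2 : R -> 'rV[R]_3) : set (R * R) :=
  [set p | [/\ 0 <= p.1 < 1, 0 <= p.2 < 1,
               proj (K1 p.1) = proj (K2 p.2)
             & height (K2 p.2) < height (K1 p.1)]].

(* +1 when the overpassing direction is turned counterclockwise, by an angle
   less than pi, onto the underpassing one (right-handed crossing). *)
Definition crossing_sign (R : realType) (K1 K2 : R -> 'rV[R]_3) (p : R * R)
    : int :=
  sgz (planar_det (derive1 K1 p.1) (derive1 K2 p.2)).

Definition sign_sum (R : realType) (K1 K2 : R -> 'rV[R]_3) : int :=
  \sum_(p \in crossings K1 K2) crossing_sign K1 K2 p.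

(* The vertical projection of the link L is a diagram: an immersion whose only
   multiple points are finitely many transverse double points. *)
Record is_diagram (R : realType) (I : Type) (L : I -> R -> 'rV[R]_3) : Prop :=
  IsDiagram {
  diagram_link : is_link L;
  diagram_immersed : forall (i : I) (t : R), proj (derive1 (L i) t) <> (0, 0);
  diagram_transverse : forall (i j : I) (s t : R),
    proj (L i s) = proj (L j t) -> L i s <> L j t ->
    planar_det (derive1 (L i) s) (derive1 (L j) t) != 0;
  diagram_double : forall (i j k : I) (r s t : R),
    proj (L i r) = proj (L j s) -> proj (L j s) = proj (L k t) ->
    [\/ L i r = L j s, L j s = L k t | L i r = L k t];
  diagram_finite : forall i j : I, finite_set (crossings (L i) (L j)) }.

Definition knot_diagram (R : realType) (K : R -> 'rV[R]_3) : Prop :=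
  is_diagram (fun _ : unit => K).

Definition writhe (R : realType) (K : R -> 'rV[R]_3) : int := sign_sum K K.

Definition pair_link (R : realType) (K1 K2 : R -> 'rV[R]_3)
  : bool -> R -> 'rV[R]_3 := fun b => if b then K1 else K2.

Definition homeomorphism (R : realType) (f : 'rV[R]_3 -> 'rV[R]_3) : Prop :=
  continuous f /\
  exists2 g : 'rV[R]_3 -> 'rV[R]_3, continuous g & cancel f g /\ cancel g f.

(* The time parameter ranges over R instead of [0, 1]; an isotopy defined on
   [0, 1] is extended by constants. *)
Definition ambient_isotopic (R : realType) (I : Type)
    (L L' : I -> R -> 'rV[R]_3) : Prop :=
  exists Phi : R * 'rV[R]_3 -> 'rV[R]_3,
    [/\ continuous Phi,
        forall tau : R, homeomorphism (fun x => Phi (tau, x)),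
        forall x : 'rV[R]_3, Phi (0, x) = x
      & forall (i : I) (t : R), Phi (1, L i t) = L' i t].

(* n is read off from some diagram of the link formed by K1 and K2, where a
   diagram of a link is the projection of a link ambient isotopic to it. *)
Definition linking_value (R : realType) (K1 K2 : R -> 'rV[R]_3) (n : rat)
    : Prop :=
  exists J1 J2 : R -> 'rV[R]_3,
    [/\ ambient_isotopic (pair_link K1 K2) (pair_link J1 J2),
        is_diagram (pair_link J1 J2)
      & n = (sign_sum J1 J2 + sign_sum J2 J1)%:~R / 2].

(* xget picks an arbitrary diagram: nothing about its independence of the
   diagram is built in. *)
Definition lk (R : realType) (K1 K2 : R -> 'rV[R]_3) : rat :=
  xget 0 [set n : rat | linking_value K1 K2 n].

Record is_framing (R : realType) (K V : R -> 'rV[R]_3) : Prop := IsFraming {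
  framing_closed : closed_curve V;
  framing_continuous : continuous V;
  framing_neq0 : forall t : R, V t != 0;
  framing_normal : forall t : R, dot (V t) (derive1 K t) = 0 }.

Definition blackboard_framing (R : realType) (K V : R -> 'rV[R]_3) : Prop :=
  is_framing K V /\ forall t : R, height (V t) = 0.

Definition shift (R : realType) (K W : R -> 'rV[R]_3) (e : R) : R -> 'rV[R]_3 :=
  fun t => K t + e *: W t.

(* A framing V is only continuous, so that K + e V need not be a smooth knot:
   the shifts are those along the smooth fields W uniformly close enough to V
   (smooth fields are dense, and W = V is allowed when V is smooth). *)
Definition self_linking_number (R : realType) (K V : R -> 'rV[R]_3) (n : rat)
    : Prop :=
  exists2 d : R, 0 < d &
    forall W : R -> 'rV[R]_3, closed_curve W -> smooth W ->
      (forall t : R, `|W t - V t| < d) ->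
      \forall e \near 0^'+,
        is_link (pair_link K (shift K W e)) /\ lk K (shift K W e) = n.

(* Main.v *)
(** The linking number is computed as a degree.  For disjoint closed curves [A] and [B] the map
    [(s, t) |-> A s - B t] sends the torus to [R^3 \ {0}]; on a fine grid its degree is the sum,
    over the cells where the height is positive, of the winding number about 0 of the projected
    boundary of the cell.  Such a sum does not change along a homotopy in [R^3 \ {0}]: a cell
    whose projection comes close to 0 has a height of constant sign, and the other cells have
    winding number 0.  For a diagram only the cells around the crossings of [A] over [B]
    contribute, each with minus the sign of the crossing, so that the degree is [- sign_sum A B];
    this makes the number read off from a diagram an isotopy invariant of the link.

    For [A = K] and [B = K + e W], with [W] transverse to [K] in the plane of projection, the
    projected difference vanishes only near the crossings of [K] (near the diagonal [s = t]
    it is about [(s - t) K' - e W]), and around these it is a small perturbation of [K s - K t].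
    Hence both degrees, for [(K, K + e W)] and [(K + e W, K)], are [- writhe K]; moreover the pair
    is itself a diagram for small [e], so that the linking number is not a default value. *)
From mathcomp Require Import all_boot all_order all_algebra.
From mathcomp Require Import lra ring zify.
From mathcomp Require Import all_classical all_reals all_analysis.
(* [Defs] comes last: its [proj] is otherwise shadowed. *)
Require Import Defs.

Set Implicit Arguments.
Unset Strict Implicit.
Unset Printing Implicit Defensive.

Import Order.TTheory GRing.Theory Num.Theory.
Import numFieldNormedType.Exports.
Local Open Scope classical_set_scope.
Local Open Scope ring_scope.

(** * Winding numbers of polygons *)

(** An ambient isotopy is only a continuous family of homeomorphisms: the curves in between need be
    neither smooth nor in general position, so no count of crossings can be followed along it. The
    degree asks only that [A s - B t] never vanishes, and sign conditions on a grid replace any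
    smooth approximation. The writhe is not itself such a degree, because [K s - K t] vanishes on
    the diagonal. The push-off removes these zeros, and transversality of [W] to [K] in projection
    keeps the projected difference away from 0 there. This transversality is what survives when the
    horizontal normal field [V] is replaced by a nearby smooth [W], which may be neither horizontal
    nor normal. Crossings with a parameter equal to 0 would sit on the edge of the square
    [[0, 1]^2], hence the translations of the parameters in the degrees. *)

Definition det2 (R : pzRingType) (a b : R * R) : R := a.1 * b.2 - a.2 * b.1.

(* Signed crossing of the segment from [a] to [b] with the ray [x > 0]; the half-open convention
   at [y = 0] makes it additive within a half-plane without any general position assumption. *)
Definition ray_crossing (R : realDomainType) (a b : R * R) : int :=
  if (a.2 < 0) && (0 <= b.2) && (0 < det2 a b) then 1
  else if (b.2 < 0) && (0 <= a.2) && (det2 a b < 0) then -1 else 0.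

Lemma ray_crossingN (R : realDomainType) (a b : R * R) :
  ray_crossing b a = - ray_crossing a b.
Proof.
have -> : ray_crossing b a =
  if (b.2 < 0) && (0 <= a.2) && (det2 a b < 0) then 1
  else if (a.2 < 0) && (0 <= b.2) && (0 < det2 a b) then -1 else 0.
  by rewrite /ray_crossing /det2 -![b.1 * a.2 - _]opprB oppr_gt0 oppr_lt0
     ![b.2 * _]mulrC ![b.1 * _]mulrC.
rewrite /ray_crossing; case: (ltrP a.2 0) => ha; case: (ltrP b.2 0) => hb //=;
  by case: ifP.
Qed.

(** An open half-plane bounded by a line through 0 contains at most one of the two rays of the
    x-axis, so all segments inside it that go from below to above the axis meet it on the same side
    of 0. Algebraically, a Plucker relation fixes the sign of [det2 c c'], and the linear relation
    between [c], [c'] and [b], read on second coordinates, then has only nonnegative terms, one of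
    them positive. *)
Lemma det2_gt0_swapl (R : realFieldType) (w a a' b : R * R) :
  0 < det2 w a -> 0 < det2 w a' -> 0 < det2 w b ->
  a.2 < 0 -> a'.2 < 0 -> 0 <= b.2 ->
  (0 < det2 a b) = (0 < det2 a' b).
Proof.
suff impl (c c' : R * R) : 0 < det2 w c -> 0 < det2 w c' -> 0 < det2 w b ->
  c.2 < 0 -> c'.2 < 0 -> 0 <= b.2 -> 0 < det2 c b -> 0 < det2 c' b.
  by move=> *; apply/idP/idP; apply: impl.
move=> wc wc' wb c2 c'2 b2 cb; case: ltrP => // c'b.
have plucker : det2 w b * det2 c c' = det2 w c' * det2 c b - det2 w c * det2 c' b.
  by rewrite /det2; ring.
have cc' : 0 < det2 c c'.
  rewrite -(pmulr_rgt0 _ wb) plucker subr_gt0.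
  apply: (@le_lt_trans _ _ 0); first by rewrite pmulr_rle0.
  exact: mulr_gt0.
have : c.2 * det2 c' b - c'.2 * det2 c b + b.2 * det2 c c' = 0.
  by rewrite /det2; ring.
have : 0 <= c.2 * det2 c' b by rewrite nmulr_rge0.
have : c'.2 * det2 c b < 0 by rewrite nmulr_rlt0.
have := mulr_ge0 b2 (ltW cc').
lra.
Qed.

Lemma det2_gt0_swapr (R : realFieldType) (w a a' b : R * R) :
  0 < det2 w a -> 0 < det2 w a' -> 0 < det2 w b ->
  0 <= a.2 -> 0 <= a'.2 -> b.2 < 0 ->
  (0 < det2 b a) = (0 < det2 b a').
Proof.
suff impl (c c' : R * R) : 0 < det2 w c -> 0 < det2 w c' -> 0 < det2 w b ->
  0 <= c.2 -> 0 <= c'.2 -> b.2 < 0 -> 0 < det2 b c -> 0 < det2 b c'.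
  by move=> *; apply/idP/idP; apply: impl.
move=> wc wc' wb c2 c'2 b2 bc; case: ltrP => // bc'.
have plucker : det2 w b * det2 c c' = det2 w c * det2 b c' - det2 w c' * det2 b c.
  by rewrite /det2; ring.
have cc' : det2 c c' < 0.
  rewrite -(pmulr_rlt0 _ wb) plucker subr_lt0.
  apply: (@le_lt_trans _ _ 0); first by rewrite pmulr_rle0.
  exact: mulr_gt0.
have : b.2 * det2 c c' - c.2 * det2 b c' + c'.2 * det2 b c = 0.
  by rewrite /det2; ring.
have : c.2 * det2 b c' <= 0 by rewrite mulr_ge0_le0.
have : 0 < b.2 * det2 c c' by rewrite nmulr_rgt0.
have := mulr_ge0 c'2 (ltW bc).
lra.
Qed.

(** Inside an open half-plane the count depends only on the side of the x-axis on which each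
    endpoint lies: it is the difference of a function of the endpoints. *)
Lemma ray_crossing_cocycle (R : realFieldType) (w a b c : R * R) :
  0 < det2 w a -> 0 < det2 w b -> 0 < det2 w c ->
  ray_crossing a b + ray_crossing b c = ray_crossing a c.
Proof.
move=> wa wb wc.
have det2N (p q : R * R) : (det2 p q < 0) = (0 < det2 q p).
  by rewrite -oppr_gt0 /det2 opprB; congr (0 < _); ring.
rewrite /ray_crossing !det2N.
case: (ltrP a.2 0) => ha; case: (ltrP b.2 0) => hb; case: (ltrP c.2 0) => hc //=;
  rewrite ?add0r ?addr0 //.
- by rewrite (det2_gt0_swapl wa wb wc).
- by rewrite (det2_gt0_swapl wa wc wb) //; case: ifP.
- by rewrite (det2_gt0_swapr wb wc wa).
- by rewrite (det2_gt0_swapl wb wc wa).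
- by rewrite (det2_gt0_swapr wa wc wb) //; case: ifP.
- by rewrite (det2_gt0_swapr wb wa wc).
Qed.

Lemma ray_crossing_path (R : realFieldType) (w : R * R) (f : nat -> R * R) (m n : nat) :
  (m <= n)%N -> (forall i, (m <= i <= n)%N -> 0 < det2 w (f i)) ->
  \sum_(m <= i < n) ray_crossing (f i) (f i.+1) = ray_crossing (f m) (f n).
Proof.
elim: n => [|n IH] mn wf.
  move: mn wf; rewrite leqn0 => /eqP -> _.
  rewrite big_geq // /ray_crossing; case: ltrP => //=; by case: ltrP.
move: mn; rewrite leq_eqVlt => /orP[/eqP ->|mn].
  rewrite big_geq // /ray_crossing; case: ltrP => //=; by case: ltrP.
rewrite big_nat_recr //= IH //; last first.
  by move=> i /andP[mi im]; apply: wf; rewrite mi leqW.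
by apply: (@ray_crossing_cocycle _ w); apply: wf; rewrite ?leqnn ?leqnSn ?andbT // ltnW.
Qed.

(** The parallelogram turns once around 0. By central symmetry its four sides share one determinant,
    and exactly one of them is counted on the positive ray. *)
Lemma ray_crossing_parallelogram (R : realFieldType) (p q : R * R) :
  det2 p q != 0 ->
  ray_crossing p q + ray_crossing q (- p) + ray_crossing (- p) (- q)
    + ray_crossing (- q) p = sgz (det2 p q).
Proof.
rewrite /ray_crossing /=.
have -> : det2 q (- p) = det2 p q by rewrite /det2 /=; ring.
have -> : det2 (- p) (- q) = det2 p q by rewrite /det2 /=; ring.
have -> : det2 (- q) p = det2 p q by rewrite /det2 /=; ring.
rewrite !oppr_lt0 !oppr_ge0 => pq0.
have : ~~ ((p.2 == 0) && (q.2 == 0)).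
  by apply: contra pq0 => /andP[/eqP p0 /eqP q0]; rewrite /det2 p0 q0 mulr0 mul0r subrr.
rewrite /sgz.
case: (ltrgtP p.2 0) => p2; case: (ltrgtP q.2 0) => q2;
  case: (ltrgtP (det2 p q) 0) pq0 => //= pq _ _.
Qed.

(* Along the four sides of the loop, [c] stays in the same four half-planes as
   the parallelogram with vertices [-a + b], [a + b], [a - b], [-a - b]. *)
Lemma ray_crossing_quadrilateral (R : realFieldType) (a b c1 c2 c3 c4 : R * R) :
  det2 a b != 0 ->
  0 < det2 a b * det2 a c1 -> det2 a b * det2 c1 b < 0 ->
  0 < det2 a b * det2 a c2 -> 0 < det2 a b * det2 c2 b ->
  det2 a b * det2 a c3 < 0 -> 0 < det2 a b * det2 c3 b ->
  det2 a b * det2 a c4 < 0 -> det2 a b * det2 c4 b < 0 ->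
  ray_crossing c1 c2 + ray_crossing c2 c3 + ray_crossing c3 c4 + ray_crossing c4 c1
    = - sgz (det2 a b).
Proof.
set D := det2 a b => D0 c1b c1l c2b c2r c3t c3r c4t c4l.
have DD : 0 < D * D by rewrite -expr2 exprn_even_gt0.
(* The sign of [D] is unknown: scaling the normal by [D] turns each hypothesis into membership in a
   half-plane. *)
pose sc (x : R) (v : R * R) : R * R := (x * v.1, x * v.2).
have scl x (u v : R * R) : det2 (sc x u) v = x * det2 u v by rewrite /det2 /sc /=; ring.
pose p := b - a; pose q := a + b.
have eap : det2 a p = D by rewrite /p /D /det2 /=; ring.
have eaq : det2 a q = D by rewrite /q /D /det2 /=; ring.
have epb : det2 p b = - D by rewrite /p /D /det2 /=; ring.
have eqb : det2 q b = D by rewrite /q /D /det2 /=; ring.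
have eN (u v : R * R) : det2 u (- v) = - det2 u v by rewrite /det2 /=; ring.
have eNl (u v : R * R) : det2 (- u) v = - det2 u v by rewrite /det2 /=; ring.
have epq : det2 p q = - (D + D) by rewrite /p /q /D /det2 /=; ring.
have swap (u v : R * R) : det2 u v = - det2 v u by rewrite /det2 /=; ring.
(* Each side is rerouted through two vertices of the parallelogram within one half-plane; the
   connecting segments are run twice in opposite directions and cancel. *)
have H1 : ray_crossing c1 c2 = ray_crossing c1 p + ray_crossing p q + ray_crossing q c2.
  rewrite (@ray_crossing_cocycle _ (sc D a)) ?scl ?eap ?eaq //.
  by rewrite (@ray_crossing_cocycle _ (sc D a)) ?scl ?eap ?eaq //.
have H2 : ray_crossing c2 c3 = ray_crossing c2 q + ray_crossing q (- p) + ray_crossing (- p) c3.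
  have h v : det2 (sc (- D) b) v = D * det2 v b by rewrite scl (swap b); ring.
  rewrite (@ray_crossing_cocycle _ (sc (- D) b)) ?h ?eNl ?epb ?eqb ?opprK //.
  by rewrite (@ray_crossing_cocycle _ (sc (- D) b)) ?h ?eNl ?epb ?eqb ?opprK //.
have H3 : ray_crossing c3 c4 = ray_crossing c3 (- p) + ray_crossing (- p) (- q)
     + ray_crossing (- q) c4.
  rewrite (@ray_crossing_cocycle _ (sc (- D) a)) ?scl ?eN ?eap ?eaq ?mulrNN ?mulNr ?oppr_gt0 //.
  by rewrite (@ray_crossing_cocycle _ (sc (- D) a)) ?scl ?eN ?eap ?eaq ?mulrNN ?mulNr ?oppr_gt0 //.
have H4 : ray_crossing c4 c1 = ray_crossing c4 (- q) + ray_crossing (- q) p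
     + ray_crossing p c1.
  have h v : det2 (sc D b) v = - (D * det2 v b) by rewrite scl (swap b); ring.
  rewrite (@ray_crossing_cocycle _ (sc D b)) ?h ?eNl ?epb ?eqb ?mulrN ?opprK ?oppr_gt0 //.
  by rewrite (@ray_crossing_cocycle _ (sc D b)) ?h ?eNl ?epb ?eqb ?mulrN ?opprK ?oppr_gt0 //.
have pq0 : det2 p q != 0 by rewrite epq oppr_eq0 -mulr2n mulrn_eq0.
have := ray_crossing_parallelogram pq0.
(* Origin of the minus sign: the vertices are met in the order opposite to the orientation of
   [(a, b)]. *)
have -> : sgz (det2 p q) = - sgz D.
  rewrite epq sgzN -[D + D]/(D *+ 2) -mulr_natl sgzM [sgz 2]gtr0_sgz ?mul1r //.
rewrite H1 H2 H3 H4 => <-.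
rewrite (ray_crossingN p c1) (ray_crossingN c2 q) (ray_crossingN c3 (- p)).
rewrite (ray_crossingN c4 (- q)).
ring.
Qed.

(** * Degree on a grid *)

(** The last two sides are written as reversed grid edges, so that an edge common to two cells is
    literally the same term with opposite signs. *)
Definition cell_winding (R : realDomainType) (f : nat -> nat -> R * R) (i j : nat) : int :=
  ray_crossing (f i j) (f i.+1 j) + ray_crossing (f i.+1 j) (f i.+1 j.+1)
  - ray_crossing (f i j.+1) (f i.+1 j.+1) - ray_crossing (f i j) (f i j.+1).

(** The mask is read at one corner only: where it changes within a cell, the winding number will be
    0. *)
Definition grid_degree (R : realDomainType) (N : nat) (f : nat -> nat -> R * R)
    (up : nat -> nat -> bool) : int :=
  \sum_(0 <= i < N) \sum_(0 <= j < N) (if up i j then cell_winding f i j else 0).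

Lemma cell_winding_half_plane (R : realFieldType) (w : R * R) (f : nat -> nat -> R * R)
    (i j : nat) :
  (forall a b : bool, 0 < det2 w (f (i + a)%N (j + b)%N)) -> cell_winding f i j = 0.
Proof.
move=> wf; have := wf false false; have := wf false true.
have := wf true false; have := wf true true.
rewrite !addn0 !addn1 /cell_winding => w11 w10 w01 w00.
rewrite (ray_crossing_cocycle w00 w10 w11) -(ray_crossing_cocycle w00 w01 w11); ring.
Qed.

Lemma sum_cyclic_shift (N : nat) (F : nat -> int) :
  F N = F 0%N -> \sum_(0 <= i < N) F i.+1 = \sum_(0 <= i < N) F i.
Proof.
case: N => [|N] FN; first by rewrite !big_geq.
by rewrite big_nat_recr //= big_nat_recl //= FN addrC.
Qed.

(** Summation by parts around a cycle: moving [h] by one index costs a term only where the mask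
    changes, and [h] vanishes there. *)
Lemma sum_by_parts_cyclic (N : nat) (M : nat -> bool) (h : nat -> int) :
  M N = M 0%N -> h N = h 0%N ->
  (forall j, (j < N)%N -> M j != M j.+1 -> h j.+1 = 0) ->
  \sum_(0 <= j < N) (if M j then h j.+1 else 0) = \sum_(0 <= j < N) (if M j then h j else 0).
Proof.
move=> MN hN Mh.
rewrite -(@sum_cyclic_shift N (fun j => if M j then h j else 0)) ?MN ?hN //.
apply: eq_big_nat => j /andP[_ jN].
by case: (eqVneq (M j) (M j.+1)) => [->|/(Mh _ jN) ->] //; rewrite !if_same.
Qed.

(** Cells of the first kind have winding number 0 for both maps, whatever their masks; on the others
    the masks agree. The difference of the degrees is thus a masked sum of a discrete coboundary,
    and only edges between cells of different masks could contribute. Such an edge belongs to a cell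
    of the first kind, where its term vanishes by the cocycle relation. *)
Lemma grid_degree_step (R : realFieldType) (N : nat) (f f' : nat -> nat -> R * R)
    (up up' : nat -> nat -> bool) :
  (forall j, f N j = f 0%N j) -> (forall i, f i N = f i 0%N) ->
  (forall j, f' N j = f' 0%N j) -> (forall i, f' i N = f' i 0%N) ->
  (forall j, up N j = up 0%N j) -> (forall i, up i N = up i 0%N) ->
  (forall i j, (i < N)%N -> (j < N)%N ->
    (exists w, forall a b : bool, 0 < det2 w (f (i + a)%N (j + b)%N) /\
                                  0 < det2 w (f' (i + a)%N (j + b)%N)) \/
    (exists u, forall a b : bool, up (i + a)%N (j + b)%N = u /\
                                  up' (i + a)%N (j + b)%N = u)) ->
  grid_degree N f up = grid_degree N f' up'.
Proof.
move=> fN1 fN2 f'N1 f'N2 uN1 uN2 cell.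
have hor i j : (i < N)%N -> (j < N)%N -> forall b : bool,
  (exists w, [/\ 0 < det2 w (f i (j + b)%N), 0 < det2 w (f i.+1 (j + b)%N),
       0 < det2 w (f' i (j + b)%N) & 0 < det2 w (f' i.+1 (j + b)%N)])
  \/ up i j = up i j.+1.
  move=> iN jN b; have [[w wf]|[u uu]] := cell i j iN jN; [left|right].
    exists w; have [] := wf false b; have [] := wf true b.
    by rewrite addn0 addn1.
  have [+ _] := uu false false; have [+ _] := uu false true.
  by rewrite !addn0 addn1 => -> ->.
have ver i j : (i < N)%N -> (j < N)%N -> forall a : bool,
  (exists w, [/\ 0 < det2 w (f (i + a)%N j), 0 < det2 w (f (i + a)%N j.+1),
       0 < det2 w (f' (i + a)%N j) & 0 < det2 w (f' (i + a)%N j.+1)])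
  \/ up i j = up i.+1 j.
  move=> iN jN a; have [[w wf]|[u uu]] := cell i j iN jN; [left|right].
    exists w; have [] := wf a false; have [] := wf a true.
    by rewrite addn0 addn1.
  have [+ _] := uu false false; have [+ _] := uu true false.
  by rewrite !addn0 addn1 => -> ->.
(* [h] and [v] are the failures of the edge terms of [f'] and [f] to be cobordant
   through the segments [f i j -> f' i j]. *)
pose e i j := ray_crossing (f i j) (f' i j).
pose h i j := ray_crossing (f' i j) (f' i.+1 j) - ray_crossing (f i j) (f i.+1 j)
  + e i j - e i.+1 j.
pose v i j := ray_crossing (f' i j) (f' i j.+1) - ray_crossing (f i j) (f i j.+1)
  + e i j - e i j.+1.
have square (w p q p' q' : R * R) : 0 < det2 w p -> 0 < det2 w q -> 0 < det2 w p' -> 0 < det2 w q' ->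
  ray_crossing p' q' - ray_crossing p q + ray_crossing p p' - ray_crossing q q' = 0 :> int.
  move=> wp wq wp' wq'.
  have := ray_crossing_cocycle wp wp' wq'; have := ray_crossing_cocycle wp wq wq'.
  lia.
have h0 i j : (i < N)%N -> (j < N)%N -> up i j != up i j.+1 -> h i j.+1 = 0.
  move=> iN jN; have [[w []]|->] := hor i j iN jN true; last by rewrite eqxx.
  by rewrite addn1 => w1 w2 w3 w4 _; apply: square w1 w2 w3 w4.
have v0 i j : (i < N)%N -> (j < N)%N -> up i j != up i.+1 j -> v i.+1 j = 0.
  move=> iN jN; have [[w []]|->] := ver i j iN jN true; last by rewrite eqxx.
  by rewrite addn1 => w1 w2 w3 w4 _; apply: square w1 w2 w3 w4.
(* [up] may replace [up']: the masks differ only where both winding numbers vanish. *)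
have diff i j : (i < N)%N -> (j < N)%N ->
  (if up' i j then cell_winding f' i j else 0) - (if up i j then cell_winding f i j else 0)
  = if up i j then h i j - h i j.+1 + (v i.+1 j - v i j) else 0.
  move=> iN jN; have cw : cell_winding f' i j - cell_winding f i j =
      h i j - h i j.+1 + (v i.+1 j - v i j).
    by rewrite /cell_winding /h /v; ring.
  have [[w wf]|[u uu]] := cell i j iN jN; last first.
    have [] := uu false false; rewrite !addn0 => -> ->.
    by case: ifP => // _; rewrite subrr.
  have f0 : cell_winding f i j = 0.
    by apply: (@cell_winding_half_plane _ w) => a b; case: (wf a b).
  have f'0 : cell_winding f' i j = 0.
    by apply: (@cell_winding_half_plane _ w) => a b; case: (wf a b).
  by rewrite -cw f0 f'0 !subrr; do !case: ifP => _; rewrite ?subrr.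
apply/esym/eqP; rewrite -subr_eq0 /grid_degree -sumrB; apply/eqP.
transitivity (\sum_(0 <= i < N) \sum_(0 <= j < N)
    (((if up i j then h i j else 0) - (if up i j then h i j.+1 else 0))
   + ((if up i j then v i.+1 j else 0) - (if up i j then v i j else 0)))).
  apply: eq_big_nat => i /andP[_ iN]; rewrite -sumrB; apply: eq_big_nat => j /andP[_ jN].
  by rewrite diff //; case: ifP => // _; ring.
under eq_bigr do rewrite big_split /=.
rewrite big_split /= [X in X + _]big_nat_cond [X in X + _]big1 ?add0r.
  rewrite exchange_big /= big_nat_cond big1 // => j /andP[/andP[_ jN] _].
  rewrite sumrB (@sum_by_parts_cyclic N (fun i => up i j) (fun i => v i j)) ?subrr //.
    by rewrite /v /e !fN1 !f'N1.
  by move=> i iN; apply: v0.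
move=> i /andP[/andP[_ iN] _].
rewrite sumrB (@sum_by_parts_cyclic N (up i) (h i)) ?subrr //.
  by rewrite /h /e !fN2 !f'N2.
by move=> j jN; apply: h0.
Qed.

(** Discrete Green formula: the interior edges cancel in pairs. *)
Lemma sum_cell_winding_block (R : realFieldType) (f : nat -> nat -> R * R) (a b c d : nat) :
  (a <= b)%N -> (c <= d)%N ->
  \sum_(a <= i < b) \sum_(c <= j < d) cell_winding f i j
  = \sum_(a <= i < b) ray_crossing (f i c) (f i.+1 c)
    + \sum_(c <= j < d) ray_crossing (f b j) (f b j.+1)
    - \sum_(a <= i < b) ray_crossing (f i d) (f i.+1 d)
    - \sum_(c <= j < d) ray_crossing (f a j) (f a j.+1).
Proof.
move=> ab cd.
transitivity (\sum_(a <= i < b) \sum_(c <= j < d)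
   (- (ray_crossing (f i j.+1) (f i.+1 j.+1) - ray_crossing (f i j) (f i.+1 j))
   + (ray_crossing (f i.+1 j) (f i.+1 j.+1) - ray_crossing (f i j) (f i j.+1)))).
  by apply: eq_bigr => i _; apply: eq_bigr => j _; rewrite /cell_winding; ring.
under eq_bigr do rewrite big_split /= sumrN telescope_sumr //.
rewrite big_split /= exchange_big /= sumrN sumrB.
under [X in _ + X]eq_bigr do rewrite (@telescope_sumr _ a b (fun i => ray_crossing (f i _) (f i _))) //.
rewrite sumrB; ring.
Qed.

(** The hypotheses are those satisfied by the linear model [u p - v q] on a rectangle around 0, with
    [u] increasing in [i] and [v] in [j]; its Jacobian is [- det2 p q], hence the sign. Each side of
    the block stays in a half-plane and counts as its chord. *)
Lemma block_winding (R : realFieldType) (f : nat -> nat -> R * R) (p q : R * R)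
    (a b c d : nat) :
  (a <= b)%N -> (c <= d)%N -> det2 p q != 0 ->
  (forall i, (a <= i <= b)%N ->
     0 < det2 p q * det2 p (f i c) /\ det2 p q * det2 p (f i d) < 0) ->
  (forall j, (c <= j <= d)%N ->
     det2 p q * det2 (f a j) q < 0 /\ 0 < det2 p q * det2 (f b j) q) ->
  \sum_(a <= i < b) \sum_(c <= j < d) cell_winding f i j = - sgz (det2 p q).
Proof.
move=> ab cd D0 hor ver; rewrite sum_cell_winding_block //.
have eD (x y : R) (u : R * R) : det2 (x * p.1, x * p.2) u = x * det2 p u /\
  det2 (x * q.1, x * q.2) u = - (x * det2 u q) by rewrite /det2 /=; split; ring.
set D := det2 p q in hor ver eD *.
rewrite (@ray_crossing_path _ (D * p.1, D * p.2) (fun i => f i c)) //; last first.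
  by move=> i /hor[h _]; rewrite (eD _ 0 _).1.
rewrite (@ray_crossing_path _ (- D * p.1, - D * p.2) (fun i => f i d)) //; last first.
  by move=> i /hor[_ h]; rewrite (eD _ 0 _).1 mulNr oppr_gt0.
rewrite (@ray_crossing_path _ (D * q.1, D * q.2) (fun j => f a j)) //; last first.
  by move=> j /ver[h _]; rewrite (eD _ 0 _).2 oppr_gt0.
rewrite (@ray_crossing_path _ (- D * q.1, - D * q.2) (fun j => f b j)) //; last first.
  by move=> j /ver[_ h]; rewrite (eD _ 0 _).2 mulNr opprK.
have hc i : (a <= i <= b)%N -> 0 < D * det2 p (f i c) by move/hor => [].
have hd i : (a <= i <= b)%N -> D * det2 p (f i d) < 0 by move/hor => [].
have va j : (c <= j <= d)%N -> D * det2 (f a j) q < 0 by move/ver => [].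
have vb j : (c <= j <= d)%N -> 0 < D * det2 (f b j) q by move/ver => [].
have aa : (a <= a <= b)%N by rewrite leqnn.
have bb : (a <= b <= b)%N by rewrite leqnn ab.
have cc : (c <= c <= d)%N by rewrite leqnn.
have dd : (c <= d <= d)%N by rewrite leqnn cd.
rewrite -(@ray_crossing_quadrilateral _ p q (f a c) (f b c) (f b d) (f a d)) //;
  try by [apply: hc | apply: hd | apply: va | apply: vb].
rewrite (ray_crossingN (f a d) (f b d)) (ray_crossingN (f a c) (f a d)); ring.
Qed.

(** * Homotopy invariance of the degree *)

Definition degree (R : realType) (N : nat) (G : R -> R -> 'rV[R]_3) : int :=
  grid_degree N (fun i j => proj (G (i%:R / N%:R) (j%:R / N%:R)))
    (fun i j => 0 < height (G (i%:R / N%:R) (j%:R / N%:R))).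

Lemma lebesgue_number (R : realType) (X : pseudoMetricType R) (A : set X)
    (C : set (set X)) :
  compact A -> (forall x, A x -> exists2 U, C U & nbhs x U) ->
  exists2 e : R, 0 < e & forall x, A x -> exists2 U, C U & ball x e `<=` U.
Proof.
move=> /compact_near_coveringP cA cov.
suff near_e : \forall e \near 0^'+, forall x, A x -> exists2 U, C U & ball x e `<=` U.
  have [e [e0 He]] := filter_ex (filterI (nbhs_right_gt (0 : R)) near_e).
  by exists e.
(* Near-covering form of compactness, used throughout: a property of [(e, x)] that holds for [x]
   near each point of [A] and small [e > 0] holds on all of [A] once [e] is small. Halving [r]
   leaves room for the ball around a nearby point. *)
apply: (cA _ (0^'+) (fun e x => exists2 U, C U & ball x e `<=` U)).
move=> x Ax; have [U CU /nbhs_ballP[r /= r0 rU]] := cov x Ax.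
have r20 : 0 < r / 2 by rewrite divr_gt0.
exists (ball x (r / 2), [set e | 0 < e < r / 2]) => /=.
  split; first exact: nbhsx_ballx.
  near=> e; apply/andP; split; near: e; first exact: nbhs_right_gt.
  exact: nbhs_right_lt.
move=> [y e] /= [xy /andP[e0 er]]; exists U => // z yz; apply: rU.
rewrite (splitr r); apply: ball_triangle xy _.
by apply: le_ball yz; exact: ltW.
Unshelve. all: by end_near. Qed.

Lemma row3_neq0 (R : realType) (v : 'rV[R]_3) : v != 0 ->
  [\/ xcoord v != 0, ycoord v != 0 | height v != 0].
Proof.
move=> v0; case: (eqVneq (xcoord v) 0) => [x0|]; last by constructor 1.
case: (eqVneq (ycoord v) 0) => [y0|]; last by constructor 2.
case: (eqVneq (height v) 0) => [z0|]; last by constructor 3.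
case/eqP: v0; apply/rowP => i; rewrite mxE.
case: i => -[|[|[|//]]] Hi; [rewrite -x0|rewrite -y0|rewrite -z0];
  by congr (v 0 _); apply: val_inj; rewrite /= inordK.
Qed.

Lemma continuous_coord_comp (R : realType) (T : topologicalType) (F : T -> 'rV[R]_3)
    (k : 'I_3) (x : T) :
  {for x, continuous F} -> {for x, continuous (fun y => F y 0 k)}.
Proof.
move=> cF; apply: (@continuous_comp _ _ _ F (fun M : 'rV[R]_3 => M 0 k)) => //.
exact: coord_continuous.
Qed.

(** On a fine grid of [[0, 1]^3] some coordinate keeps a strict sign on all corners of each small
    cube: one of the first two gives the half-plane, the height gives the constant mask that
    [grid_degree_step] asks for. The homotopy parameter is cut with the same mesh, so that [N] steps
    lead from 0 to 1. *)
Lemma degree_homotopy (R : realType) (H : R * R * R -> 'rV[R]_3) :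
  continuous H ->
  (forall r s t, H (r, s + 1, t) = H (r, s, t)) ->
  (forall r s t, H (r, s, t + 1) = H (r, s, t)) ->
  (forall q, H q != 0) ->
  \forall N \near \oo, degree N (fun s t => H (0, s, t)) = degree N (fun s t => H (1, s, t)).
Proof.
move=> cH Hs Ht H0.
pose I01 : set R := `[0, 1]%classic.
have cI : compact (I01 `*` I01 `*` I01).
  by apply: compact_setX; [apply: compact_setX|]; exact: segment_compact.
pose C : set (set (R * R * R)) := [set U | exists k : 'I_3, exists c : R,
  forall q, U q -> 0 < c * H q 0 k].
have cov q : (I01 `*` I01 `*` I01) q -> exists2 U, C U & nbhs q U.
  move=> _; have [k Hk] : exists k : 'I_3, H q 0 k != 0.
    by have [h|h|h] := row3_neq0 (H0 q); [exists (inord 0)|exists (inord 1)|exists (inord 2)].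
  exists [set q' | 0 < H q 0 k * H q' 0 k]; first by exists k, (H q 0 k).
  have cc : {for q, continuous (fun q' => H q 0 k * H q' 0 k)}.
    apply: continuousM; first exact: cst_continuous.
    exact/continuous_coord_comp/cH.
  by apply: (cvgr_gt _ cc); rewrite -expr2 exprn_even_gt0.
have [e e0 He] := lebesgue_number cI cov.
near=> N.
have Ne : e^-1 < N%:R by near: N; exact: nbhs_infty_gtr.
have NR : 0 < N%:R :> R by apply: lt_trans Ne; rewrite invr_gt0.
have N0 : (0 < N)%N by rewrite -(ltr0n R).
have {}Ne : N%:R^-1 < e by rewrite -[e]invrK ltf_pV2 ?posrE ?invr_gt0.
pose x (i : nat) : R := i%:R / N%:R.
have x01 i : (i < N)%N -> I01 (x i).
  move=> iN; rewrite /I01 /= in_itv /= divr_ge0 //= ler_pdivrMr // mul1r ler_nat.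
  exact: ltnW.
have xS i (b : bool) : ball (x i) e (x (i + b)%N).
  rewrite /ball /= /x natrD mulrDl opprD addrA subrr sub0r normrN.
  case: b; last by rewrite mul0r normr0.
  by rewrite mul1r ger0_norm ?invr_ge0.
have x0 : x 0 = 0 by rewrite /x mul0r.
have xN : x N = 1 by rewrite /x divff // gt_eqF.
have step k : (k < N)%N -> degree N (fun s t => H (x k, s, t))
    = degree N (fun s t => H (x k.+1, s, t)).
  move=> kN; rewrite /degree; rewrite -/(x _).
  have Hs1 r t : H (r, N%:R / N%:R, t) = H (r, 0%:R / N%:R, t).
    by rewrite -!/(x _) xN x0 -(Hs r 0 t) add0r.
  have Ht1 r s : H (r, s, N%:R / N%:R) = H (r, s, 0%:R / N%:R).
    by rewrite -!/(x _) xN x0 -(Ht r s 0) add0r.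
  apply: grid_degree_step => [j|i|j|i|j|i|i j iN jN]; rewrite ?Hs1 ?Ht1 //.
  have [|U [m [c Uc]] bU] := He (x k, x i, x j).
    by split; [split|]; apply: x01.
  have {}Uc (d a b : bool) : 0 < c * H (x (k + d)%N, x (i + a)%N, x (j + b)%N) 0 m.
    by apply: Uc; apply: bU; split => /=; [split => /=|]; apply: xS.
  have U0 a b := Uc false a b; have U1 a b := Uc true a b.
  rewrite addn0 in U0; rewrite addn1 in U1.
  have [m0|m1|m2] : [\/ m = inord 0, m = inord 1 | m = inord 2].
    case: m {Uc U0 U1} => -[|[|[|//]]] Hm.
    - by constructor 1; apply: val_inj; rewrite /= inordK.
    - by constructor 2; apply: val_inj; rewrite /= inordK.
    - by constructor 3; apply: val_inj; rewrite /= inordK.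
  (* [det2 (0, - c)] is [c] times the first coordinate; below, [det2 (c, 0)] is [c] times the
     second. *)
  - left; exists (0, - c) => a b; rewrite /det2 /= !mul0r !sub0r !mulNr !opprK.
    by rewrite /xcoord -m0; split; [exact: U0|exact: U1].
  - left; exists (c, 0) => a b; rewrite /det2 /= !mul0r !subr0.
    by rewrite /ycoord -m1; split; [exact: U0|exact: U1].
  right; exists (0 < c) => a b; rewrite /height -m2.
  have := U0 a b; have := U1 a b; rewrite /x.
  case: (ltrgtP c 0) => [cn|cp|->]; last by rewrite mul0r ltxx.
    by rewrite (nmulr_rgt0 _ cn) (nmulr_rgt0 _ cn) => h1 h0; split; exact: lt_gtF.
  by rewrite (pmulr_rgt0 _ cp) (pmulr_rgt0 _ cp).
suff all k : (k <= N)%N -> degree N (fun s t => H (0, s, t)) = degree N (fun s t => H (x k, s, t)).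
  by rewrite (all N) // xN.
elim: k => [_|k IH kN]; first by rewrite x0.
by rewrite -(step _ kN); apply: IH; exact: ltnW.
Unshelve. all: by end_near. Qed.

Lemma cvg_comp_continuous (T : Type) (U V : topologicalType) (F : set_system T)
    (h : U -> V) (f : T -> U) (a : U) :
  continuous h -> f x @[x --> F] --> a -> h (f x) @[x --> F] --> h a.
Proof. by move=> ch fa; apply: (@cvg_comp _ _ _ f h _ (nbhs a)) => //; exact: ch. Qed.

Lemma cvg_comp2_continuous (T : Type) (U V W : topologicalType) (F : set_system T)
    (FF : Filter F) (h : U * V -> W) (f : T -> U) (g : T -> V) (a : U) (b : V) :
  continuous h -> f x @[x --> F] --> a -> g x @[x --> F] --> b ->
  h (f x, g x) @[x --> F] --> h (a, b).
Proof.
by move=> ch fa gb; apply: (@cvg_comp_continuous _ _ _ F h) => //; exact: cvg_pair.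
Qed.

(** The difference of the two moving curves never vanishes, since each stage of the isotopy is
    injective and the initial curves are disjoint. *)
Lemma degree_isotopic (R : realType) (I : Type) (L J : I -> R -> 'rV[R]_3) (i j : I)
    (e e' : R) :
  closed_curve (L i) -> closed_curve (L j) -> continuous (L i) -> continuous (L j) ->
  (forall s t, L i s <> L j t) -> ambient_isotopic L J ->
  \forall N \near \oo, degree N (fun s t => L i (s - e) - L j (t - e))
                     = degree N (fun s t => J i (s - e') - J j (t - e')).
Proof.
move=> K1c K2c K1cont K2cont K12 [Phi [Phic Phih Phi0 Phi1]].
set K1 := L i in K1c K1cont K12 *; set K2 := L j in K2c K2cont K12 *.
(* The windows suited to the two links are unrelated, so the translation is interpolated along the
   isotopy. *)
pose c (r : R) := e + r * (e' - e).
pose H (q : R * R * R) := Phi (q.1.1, K1 (q.1.2 - c q.1.1)) - Phi (q.1.1, K2 (q.2 - c q.1.1)).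
have Hc : continuous H.
  move=> q; have r_q : q'.1.1 @[q' --> q] --> q.1.1.
    by apply: (@cvg_comp _ _ _ fst fst); apply: cvg_fst.
  have s_q : q'.1.2 @[q' --> q] --> q.1.2.
    by apply: (@cvg_comp _ _ _ fst snd); [apply: cvg_fst|apply: cvg_snd].
  have t_q : q'.2 @[q' --> q] --> q.2 by apply: cvg_snd.
  have c_q : c q'.1.1 @[q' --> q] --> c q.1.1.
    apply: cvgD; first exact: cvg_cst.
    by apply: cvgM; [exact: r_q|exact: cvg_cst].
  apply: cvgB; apply: cvg_comp2_continuous => //.
    by apply: cvg_comp_continuous => //; exact: cvgB.
  by apply: cvg_comp_continuous => //; exact: cvgB.
have Phi_inj r x y : Phi (r, x) = Phi (r, y) -> x = y.
  by have [_ [g _ [fg _]]] := Phih r; move/(congr1 g); rewrite !fg.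
have := @degree_homotopy _ H Hc; rewrite /H /=.
have -> : (fun s t => Phi (0, K1 (s - c 0)) - Phi (0, K2 (t - c 0)))
    = (fun s t => K1 (s - e) - K2 (t - e)).
  by apply/funext => s; apply/funext => t; rewrite !Phi0 /c mul0r addr0.
have -> : (fun s t => Phi (1, K1 (s - c 1)) - Phi (1, K2 (t - c 1)))
    = (fun s t => J i (s - e') - J j (t - e')).
  apply/funext => s; apply/funext => t; have -> : c 1 = e' by rewrite /c mul1r addrC subrK.
  by rewrite !Phi1.
apply.
- by move=> r s t; rewrite addrAC K1c.
- by move=> r s t; rewrite [t + 1 - _]addrAC K2c.
by move=> q; apply/eqP => /subr0_eq /Phi_inj; exact: K12.
Qed.

(** * Localization of the degree around the zeros of the projection *)

Lemma grid_index (R : realType) (N : nat) (x : R) : (0 < N)%N -> 0 <= x ->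
  let a := (Num.truncn (x * N%:R)).+1 in
  [/\ forall i, (i < a)%N = (i%:R / N%:R <= x),
      x < a%:R / N%:R & a%:R / N%:R <= x + N%:R^-1].
Proof.
move=> N0 x0; have NR : 0 < N%:R :> R by rewrite ltr0n.
have ia i : (i < (Num.truncn (x * N%:R)).+1)%N = (i%:R / N%:R <= x).
  by rewrite ltnS truncn_ge_nat ?ler_pdivrMr // mulr_ge0 // ltW.
move=> a; split => //.
  by rewrite ltNge -ia /a ltnn.
by rewrite /a -natr1 mulrDl mul1r lerD2r -ia.
Qed.

Lemma sum_nat_interval (N a b : nat) (F : nat -> int) : (b <= N)%N ->
  \sum_(0 <= i < N) (if (a <= i < b)%N then F i else 0) = \sum_(a <= i < b) F i.
Proof.
move=> bN; rewrite -big_mkcond /= [RHS](big_nat_widenl _ 0) // [RHS](big_nat_widen _ _ N) //=.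
Qed.

(** Around [p] the model is [u al - v be]. Its sign conditions are asked only on the frame between
    the squares of radii [d1] and [d2], through which the sides of a block of cells run, so that
    [block_winding] applies. Elsewhere the projection avoids 0 and a small cell lies in a
    half-plane. The height has a constant sign on the [d2]-square, so a block counts as a whole or
    not at all. *)
Lemma degree_localize (R : realType) (G : R -> R -> 'rV[R]_3) (Z : seq (R * R))
    (al be : R * R -> R * R) (up : R * R -> bool) (d1 d2 : R) :
  continuous (fun q : R * R => G q.1 q.2) -> uniq Z -> 0 < d1 < d2 ->
  (forall p, p \in Z -> [/\ d2 < p.1, p.1 + d2 < 1, d2 < p.2 & p.2 + d2 < 1]) ->
  (forall p p' s t, p \in Z -> p' \in Z -> `|s - p.1| <= d2 -> `|t - p.2| <= d2 ->
     `|s - p'.1| <= d2 -> `|t - p'.2| <= d2 -> p = p') ->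
  (forall p, p \in Z -> det2 (al p) (be p) != 0) ->
  (forall p u v, p \in Z -> `|u| <= d2 -> d1 <= `|v| <= d2 ->
     0 < - v * (det2 (al p) (be p) * det2 (al p) (proj (G (p.1 + u) (p.2 + v))))) ->
  (forall p u v, p \in Z -> `|v| <= d2 -> d1 <= `|u| <= d2 ->
     0 < u * (det2 (al p) (be p) * det2 (proj (G (p.1 + u) (p.2 + v))) (be p))) ->
  (forall p u v, p \in Z -> `|u| <= d2 -> `|v| <= d2 ->
     (0 < height (G (p.1 + u) (p.2 + v))) = up p) ->
  (forall s t, 0 <= s <= 1 -> 0 <= t <= 1 ->
     (forall p, p \in Z -> ~ (`|s - p.1| < d1 /\ `|t - p.2| < d1)) ->
     proj (G s t) <> (0, 0)) ->
  \forall N \near \oo, degree N G = - \sum_(p <- Z | up p) sgz (det2 (al p) (be p)).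
Proof.
move=> cG uZ /andP[d10 d12] Zin Zdisj D0 hor ver hei out.
pose I01 : set R := `[0, 1]%classic.
have cI : compact (I01 `*` I01) by apply: compact_setX; exact: segment_compact.
pose C : set (set (R * R)) := [set U |
  (exists2 p, p \in Z & forall q, U q -> `|q.1 - p.1| < d1 /\ `|q.2 - p.2| < d1) \/
  (exists w, forall q, U q -> 0 < det2 w (proj (G q.1 q.2)))].
have ck (k : 'I_3) : continuous (fun q : R * R => G q.1 q.2 0 k).
  by move=> q; apply: continuous_coord_comp; exact: cG.
have cov q : (I01 `*` I01) q -> exists2 U, C U & nbhs q U.
  rewrite /I01 => -[/=]; rewrite !in_itv /= => q1 q2.
  have [[p pZ [p1 p2]]|nblk] := pselect (exists2 p, p \in Z & `|q.1 - p.1| < d1 /\ `|q.2 - p.2| < d1).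
    exists [set q | `|q.1 - p.1| < d1 /\ `|q.2 - p.2| < d1]; first by left; exists p.
    exists (ball p.1 d1, ball p.2 d1) => /=; first split.
    - apply: open_nbhs_nbhs; split; first exact: ball_open.
      by rewrite /ball /= distrC.
    - apply: open_nbhs_nbhs; split; first exact: ball_open.
      by rewrite /ball /= distrC.
    by move=> x /= [x1 x2]; split; rewrite distrC.
  have Gq : proj (G q.1 q.2) <> (0, 0).
    by apply: out => // p pZ h; apply: nblk; exists p.
  have cw (w : R * R) : continuous (fun q : R * R => det2 w (proj (G q.1 q.2))).
    move=> x; rewrite /det2 /=.
    by apply: cvgB; apply: cvgM; try exact: cvg_cst; exact: ck.
  (* [det2 w] is the inner product with [proj (G q.1 q.2)]. *)
  pose w := (ycoord (G q.1 q.2), - xcoord (G q.1 q.2)).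
  exists [set x | 0 < det2 w (proj (G x.1 x.2))]; first by right; exists w.
  apply: (cvgr_gt _ (cw w q)); rewrite /det2 /= mulNr opprK -!expr2.
  rewrite lt_neqAle addr_ge0 ?sqr_ge0 // andbT eq_sym paddr_eq0 ?sqr_ge0 // !sqrf_eq0.
  by apply/negP => /andP[/eqP h1 /eqP h2]; apply: Gq; rewrite /proj h1 h2.
have [e e0 He] := lebesgue_number cI cov.
pose d := (d1 + d2) / 2.
near=> N.
have big_N r : 0 < r -> r^-1 < N%:R -> N%:R^-1 < r :> R.
  move=> r0 rN; rewrite -[r]invrK ltf_pV2 ?posrE ?invr_gt0 //.
  by apply: lt_trans rN; rewrite invr_gt0.
have Ne : N%:R^-1 < e by apply: big_N => //; near: N; exact: nbhs_infty_gtr.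
have Nd : N%:R^-1 < (d2 - d1) / 2.
  by apply: big_N; [rewrite divr_gt0 // subr_gt0|near: N; exact: nbhs_infty_gtr].
have N0 : (0 < N)%N by near: N; exact: nbhs_infty_gt.
have NR : 0 < N%:R :> R by rewrite ltr0n.
have dd1 : d1 < d by rewrite /d; lra.
have dd2 : d + N%:R^-1 < d2 by rewrite /d; lra.
have dN : d1 < d - N%:R^-1 by rewrite /d; lra.
pose x (i : nat) : R := i%:R / N%:R.
pose lo (y : R) := (Num.truncn ((y - d) * N%:R)).+1.
pose hi (y : R) := (Num.truncn ((y + d) * N%:R)).+1.
have x01 i : (i < N)%N -> I01 (x i).
  move=> iN; rewrite /I01 /= in_itv /= divr_ge0 //= ler_pdivrMr // mul1r ler_nat.
  exact: ltnW.
have xS i (b : bool) : ball (x i) e (x (i + b)%N).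
  rewrite /ball /= /x natrD mulrDl opprD addrA subrr sub0r normrN.
  case: b; last by rewrite mul0r normr0.
  by rewrite mul1r ger0_norm ?invr_ge0.
(* The block of [p] consists of the cells whose corner is within [d] of [p];
   [d] lies strictly between [d1] and [d2], so that cells outside the block avoid
   the [d1]-square of [p], and the block stays in its [d2]-square. *)
have idx y : d2 < y -> y + d2 < 1 -> [/\
    forall i, (i < lo y)%N = (x i <= y - d), y - d < x (lo y) & x (lo y) <= y - d + N%:R^-1]
  /\ [/\ forall i, (i < hi y)%N = (x i <= y + d), y + d < x (hi y)
      & x (hi y) <= y + d + N%:R^-1] /\ (lo y <= hi y <= N)%N.
  move=> y0 y1.
  have N'0 : 0 <= N%:R^-1 :> R by rewrite invr_ge0 ltW.
  have [|l1 l2 l3] := @grid_index _ N (y - d) N0; first lra.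
  have [|h1 h2 h3] := @grid_index _ N (y + d) N0; first lra.
  split=> //; split=> //; apply/andP; split.
    have : (Num.truncn ((y - d) * N%:R) < lo y)%N by [].
    have -> : (lo y <= hi y)%N = (Num.truncn ((y - d) * N%:R) < hi y)%N by [].
    rewrite l1 h1; lra.
  have : x (hi y) < 1 by rewrite /x /hi; lra.
  by rewrite ltr_pdivrMr // mul1r ltr_nat => /ltnW.
pose blk (p : R * R) i j := (lo p.1 <= i < hi p.1)%N && (lo p.2 <= j < hi p.2)%N.
have Ninv0 : 0 < N%:R^-1 :> R by rewrite invr_gt0.
have bnd y z : y - d < z -> z <= y + d + N%:R^-1 -> `|z - y| <= d2.
  by clear -dd2 Ninv0 => h1 h2; rewrite ler_norml; apply/andP; split; lra.
have near_idx y i : d2 < y -> y + d2 < 1 -> (lo y <= i <= hi y)%N -> `|x i - y| <= d2.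
  move=> y0 y1 /andP[]; have [[l1 l2 l3] [[h1 h2 h3] _]] := idx y y0 y1.
  rewrite leqNgt l1 -ltNge => li.
  rewrite leq_eqVlt h1 => /orP[/eqP e_i|hi_i]; apply: bnd => //.
    by rewrite e_i.
  by apply: le_trans hi_i _; rewrite lerDl ltW.
have far_idx y i : d2 < y -> y + d2 < 1 -> ~~ (lo y <= i < hi y)%N -> d1 <= `|x i - y|.
  move=> y0 y1; have [[l1 l2 l3] [[h1 h2 h3] _]] := idx y y0 y1.
  rewrite negb_and -ltnNge l1 h1 -ltNge ler_normr.
  clear -dd1; move=> /orP[] h; apply/orP; [right|left]; lra.
pose T i j := if 0 < height (G (x i) (x j))
  then cell_winding (fun i j => proj (G (x i) (x j))) i j else 0.
have T_out i j : (i < N)%N -> (j < N)%N -> (forall p, p \in Z -> ~~ blk p i j) -> T i j = 0.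
  move=> iN jN nblk.
  have [|U CU bU] := He (x i, x j); first by split; apply: x01.
  case: CU => [[p pZ Up]|[w Uw]].
    have [] := Up _ (bU _ (ballxx _ e0)) => /= p1 p2.
    have [q1 q2 q3 q4] := Zin p pZ.
    have := nblk p pZ; rewrite negb_and => /orP[] /far_idx; last first.
      by move=> /(_ q3 q4); rewrite leNgt p2.
    by move=> /(_ q1 q2); rewrite leNgt p1.
  rewrite /T (@cell_winding_half_plane _ w) ?if_same // => a b.
  by apply: (Uw (x (i + a)%N, x (j + b)%N)); apply: bU; split; apply: xS.
(* By [Zdisj] the blocks are disjoint: a cell belongs to at most one of them. *)
have T_blk i j : (i < N)%N -> (j < N)%N ->
    T i j = \sum_(p <- Z) (if blk p i j then T i j else 0).
  move=> iN jN.
  have [/hasP[p pZ pij]|/hasPn nblk] := boolP (has (fun p => blk p i j) Z); last first.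
    rewrite T_out //; under eq_bigr do rewrite if_same.
    by rewrite big1.
  rewrite (bigD1_seq p) //= pij big_seq_cond big1 ?addr0 // => p' /andP[p'Z pp'].
  case: ifP => // p'ij; case/eqP: pp'.
  have [q1 q2 q3 q4] := Zin p pZ; have [q1' q2' q3' q4'] := Zin p' p'Z.
  have incl y k : (lo y <= k < hi y)%N -> (lo y <= k <= hi y)%N.
    by case/andP => -> /= /ltnW.
  move: pij p'ij => /andP[/incl a1 /incl a2] /andP[/incl b1 /incl b2].
  by apply: (Zdisj p' p (x i) (x j)) => //; apply: near_idx.
rewrite /degree /grid_degree -sumrN.
transitivity (\sum_(0 <= i < N) \sum_(0 <= j < N) \sum_(p <- Z) (if blk p i j then T i j else 0)).
  apply: eq_big_nat => i /andP[_ iN]; apply: eq_big_nat => j /andP[_ jN].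
  by rewrite -T_blk.
under eq_bigr do rewrite exchange_big /=.
rewrite exchange_big /= [RHS]big_mkcond /= big_seq_cond [RHS]big_seq_cond.
apply: eq_bigr => p /andP[pZ _].
have [q1 q2 q3 q4] := Zin p pZ.
have [[l1 l2 l3] [[h1 h2 h3] /andP[lh1 hN1]]] := idx p.1 q1 q2.
have [[l1' l2' l3'] [[h1' h2' h3'] /andP[lh2 hN2]]] := idx p.2 q3 q4.
transitivity (\sum_(lo p.1 <= i < hi p.1) \sum_(lo p.2 <= j < hi p.2) T i j).
  rewrite -(@sum_nat_interval N _ _ (fun i => \sum_(lo p.2 <= j < hi p.2) T i j)) //; apply: eq_bigr => i _.
  rewrite /blk; case: ifP => /= _; last by rewrite big1.
  exact: (@sum_nat_interval N _ _ (T i)).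
have xp i : x i = p.1 + (x i - p.1) by rewrite addrC subrK.
have xp' i : x i = p.2 + (x i - p.2) by rewrite addrC subrK.
transitivity (\sum_(lo p.1 <= i < hi p.1) \sum_(lo p.2 <= j < hi p.2)
  (if up p then cell_winding (fun i j => proj (G (x i) (x j))) i j else 0)).
  apply: eq_big_nat => i /andP[i1 i2]; apply: eq_big_nat => j /andP[j1 j2].
  by rewrite /T xp (xp' j) hei //; apply: near_idx; rewrite // ?i1 ?j1 ltnW.
case: (up p); last by rewrite big1 // => i _; rewrite big1.
have lo_far y k : x k <= y - d + N%:R^-1 -> 0 < - (x k - y) /\ d1 <= - (x k - y).
  by clear -d10 dN => h; split; lra.
have hi_far y k : y + d < x k -> 0 < x k - y /\ d1 <= x k - y.
  by clear -d10 dd1 => h; split; lra.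
have sgn_pos (r s : R) : 0 < r -> 0 < r * s -> 0 < s by move=> r0; rewrite pmulr_rgt0.
have loI y : (lo y <= hi y)%N -> (lo y <= lo y <= hi y)%N by rewrite leqnn.
have hiI y : (lo y <= hi y)%N -> (lo y <= hi y <= hi y)%N by rewrite leqnn andbT.
have [lo1 lo1'] := lo_far _ _ l3; have [lo2 lo2'] := lo_far _ _ l3'.
have [hi1 hi1'] := hi_far _ _ h2; have [hi2 hi2'] := hi_far _ _ h2'.
have := near_idx _ _ q1 q2 (loI _ lh1); have := near_idx _ _ q3 q4 (loI _ lh2).
rewrite !ler0_norm -?oppr_ge0 ?(ltW lo1) ?(ltW lo2) // => nlo2 nlo1.
have := near_idx _ _ q1 q2 (hiI _ lh1); have := near_idx _ _ q3 q4 (hiI _ lh2).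
rewrite !gtr0_norm // => nhi2 nhi1.
apply: block_winding => //; first exact: D0.
  move=> i ii; have xi := near_idx _ _ q1 q2 ii; split.
    rewrite xp (xp' (lo _)); apply: (sgn_pos _ _ lo2); apply: hor => //.
    by rewrite ler0_norm ?lo2' // -oppr_ge0 ltW.
  rewrite xp (xp' (hi _)) -oppr_gt0; apply: (sgn_pos _ _ hi2).
  rewrite mulrN -mulNr; apply: hor => //.
  by rewrite gtr0_norm // hi2'.
move=> j jj; have xj := near_idx _ _ q3 q4 jj; split.
  rewrite xp (xp' j) -oppr_gt0; apply: (sgn_pos _ _ lo1); rewrite mulrNN; apply: ver => //.
  by rewrite ler0_norm ?lo1' // -oppr_ge0 ltW.
rewrite xp (xp' j); apply: (sgn_pos _ _ hi1); apply: ver => //.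
by rewrite gtr0_norm // hi1'.
Unshelve. all: by end_near. Qed.

(** * Secants and coincidences of curves *)

Lemma smooth_derivable (R : realType) (f : R -> 'rV[R]_3) (t : R) :
  smooth f -> derivable f t 1.
Proof. by move=> /(_ 0%N t). Qed.

Lemma smooth_derivable1 (R : realType) (f : R -> 'rV[R]_3) (t : R) :
  smooth f -> derivable (derive1 f) t 1.
Proof. by move=> /(_ 1%N t). Qed.

Lemma derivable_continuous1 (R : realType) (f : R -> 'rV[R]_3) (t : R) :
  derivable f t 1 -> {for t, continuous f}.
Proof. by move=> /derivable1_diffP; exact: differentiable_continuous. Qed.

Lemma smooth_continuous (R : realType) (f : R -> 'rV[R]_3) : smooth f -> continuous f.
Proof. by move=> sf t; apply: derivable_continuous1; exact: smooth_derivable. Qed.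

Lemma smooth_continuous1 (R : realType) (f : R -> 'rV[R]_3) :
  smooth f -> continuous (derive1 f).
Proof. by move=> sf t; apply: derivable_continuous1; exact: smooth_derivable1. Qed.

Lemma is_derive_coord (R : realType) (f : R -> 'rV[R]_3) (k : 'I_3) (t : R) :
  derivable f t 1 -> is_derive t 1 (fun t => f t 0 k) (derive1 f t 0 k).
Proof.
move=> df; apply: DeriveDef; first by move/derivable_mxP : df => /(_ 0 k).
by rewrite derive1E derive_mx // mxE.
Qed.

Definition secant (R : realType) (f : R -> 'rV[R]_3) (s t : R) : 'rV[R]_3 :=
  if s == t then derive1 f t else (s - t)^-1 *: (f s - f t).

Lemma secantE (R : realType) (f : R -> 'rV[R]_3) (s t : R) :
  f s - f t = (s - t) *: secant f s t.
Proof.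
rewrite /secant; case: eqVneq => [->|st]; first by rewrite !subrr scale0r.
by rewrite scalerA divff ?scale1r // subr_eq0.
Qed.

(** The mean value theorem is applied to one coordinate at a time: the intermediate point depends on
    [k]. *)
Lemma secant_mvt (R : realType) (f : R -> 'rV[R]_3) (k : 'I_3) (s t t0 r : R) :
  smooth f -> `|t0 - s| < r -> `|t0 - t| < r ->
  exists2 c, `|t0 - c| < r & secant f s t 0 k = derive1 f c 0 k.
Proof.
move=> sf; wlog st : s t / s <= t.
  move=> H sr tr; have [st|/ltW ts] := leP s t; first exact: H.
  have [c cr e] := H _ _ ts tr sr; exists c => //; rewrite -e /secant.
  rewrite eq_sym; case: eqVneq => [-> //|tsN].
  by rewrite -opprB -[f s - f t]opprB invrN scaleNr scalerN opprK.
move=> sr tr; rewrite /secant; case: eqVneq => [_|sNt]; first by exists t.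
have {st}st : s < t by rewrite lt_neqAle sNt.
have [//|x _|x|c] := @MVT R (fun t => f t 0 k) (fun t => derive1 f t 0 k) s t.
- by apply: is_derive_coord; exact: smooth_derivable.
- apply: continuous_subspaceT => y; apply: continuous_coord_comp.
  exact: smooth_continuous.
rewrite in_itv /= => /andP[sc ct] e; exists c.
  by move: sr tr; rewrite !ltr_norml => /andP[? ?] /andP[? ?]; apply/andP; split; lra.
have st0 : s - t != 0 by rewrite subr_eq0.
apply: (mulfI st0); rewrite !mxE mulrA divff // mul1r.
by rewrite -[LHS]opprB e; ring.
Qed.

Lemma cvg_coord (R : realType) (T : Type) (F : set_system T) (FF : Filter F)
    (f : T -> 'rV[R]_3) (a : 'rV[R]_3) (k : 'I_3) :
  f x @[x --> F] --> a -> f x 0 k @[x --> F] --> a 0 k.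
Proof.
apply: (@cvg_comp_continuous _ _ _ F (fun M : 'rV[R]_3 => M 0 k)).
exact: coord_continuous.
Qed.

(** Both ends of the secant move, so this is strict differentiability: it rests on the continuity of
    the derivative. *)
Lemma secant_cvg (R : realType) (T : Type) (F : set_system T) (FF : Filter F)
    (f : R -> 'rV[R]_3) (s t : T -> R) (t0 : R) (k : 'I_3) :
  smooth f -> s x @[x --> F] --> t0 -> t x @[x --> F] --> t0 ->
  secant f (s x) (t x) 0 k @[x --> F] --> derive1 f t0 0 k.
Proof.
move=> sf st tt; apply/cvgrPdist_lt => e e0.
have : derive1 f c 0 k @[c --> t0] --> derive1 f t0 0 k.
  by apply: cvg_coord; exact: smooth_continuous1.
move=> /cvgrPdist_lt /(_ _ e0) /nbhs_ballP[r /= r0 H].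
near=> x.
have [||c cr ->] := @secant_mvt _ f k (s x) (t x) t0 r sf.
- by near: x; move/cvgrPdist_lt: st; apply.
- by near: x; move/cvgrPdist_lt: tt; apply.
exact: H.
Unshelve. all: by end_near. Qed.

Lemma cvg_det2 (R : realType) (T : Type) (F : set_system T) (FF : Filter F)
    (p q : T -> R * R) (a b : R * R) :
  (p x).1 @[x --> F] --> a.1 -> (p x).2 @[x --> F] --> a.2 ->
  (q x).1 @[x --> F] --> b.1 -> (q x).2 @[x --> F] --> b.2 ->
  det2 (p x) (q x) @[x --> F] --> det2 a b.
Proof. by move=> p1 p2 q1 q2; apply: cvgB; apply: cvgM. Qed.

Lemma closed_curve_int (R : realType) (f : R -> 'rV[R]_3) (t : R) (n : int) :
  closed_curve f -> f (t + n%:~R) = f t.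
Proof.
move=> fc; have nat_case m u : f (u + m%:R) = f u.
  elim: m => [|m IH]; first by rewrite addr0.
  by rewrite -natr1 addrA fc.
case: n => m; first exact: nat_case.
by rewrite NegzE mulrNz -(nat_case m.+1) subrK.
Qed.

Lemma closed_curve_modn (R : realType) (f : R -> 'rV[R]_3) (s t : R) :
  closed_curve f -> s - t \is a Num.int -> f s = f t.
Proof. by move=> fc /intrP[n e]; rewrite -(closed_curve_int t n) // -e addrC subrK. Qed.

Lemma closed_curve_derive1 (R : realType) (f : R -> 'rV[R]_3) :
  closed_curve f -> closed_curve (derive1 f).
Proof.
move=> fc t; rewrite /derive1 fc.
by under eq_fun do rewrite addrA fc.
Qed.

Lemma det2_scaled_eq (R : realDomainType) (x y : R) (p q : R * R) :
  det2 p q != 0 -> x * p.1 = y * q.1 -> x * p.2 = y * q.2 -> x = 0 /\ y = 0.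
Proof.
move=> pq0 e1 e2.
have /eqP : x * det2 p q = 0.
  have -> : x * det2 p q = x * p.1 * q.2 - x * p.2 * q.1 by rewrite /det2; ring.
  by rewrite e1 e2; ring.
have /eqP : y * det2 p q = 0.
  have -> : y * det2 p q = p.1 * (y * q.2) - p.2 * (y * q.1) by rewrite /det2; ring.
  by rewrite -e1 -e2; ring.
by rewrite !mulf_eq0 (negPf pq0) !orbF => /eqP -> /eqP ->.
Qed.

(* In projection a coincidence reads [(s - t) p = (b - a) q], with [p] a secant close to the
   tangent of [K] and [q] close to [W]: these are independent, so both coefficients vanish. *)
Lemma near_diagonal_coincidence (R : realType) (T : Type) (F : set_system T)
    (FF : Filter F) (K W : R -> 'rV[R]_3) (s t a b : T -> R) (s0 t0 : R) :
  smooth K -> smooth W -> closed_curve K -> closed_curve W ->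
  s0 - t0 \is a Num.int -> det2 (proj (derive1 K t0)) (proj (W t0)) != 0 ->
  s x @[x --> F] --> s0 -> t x @[x --> F] --> t0 ->
  a x @[x --> F] --> 0 -> b x @[x --> F] --> 0 ->
  \forall x \near F, proj (K (s x) + a x *: W (s x)) = proj (K (t x) + b x *: W (t x)) ->
    a x = b x /\ s x - t x = s0 - t0.
Proof.
move=> sK sW cK cW /intrP[n sn] D0 ss tt aa bb.
pose s' x := s x - n%:~R.
have s't : s' x @[x --> F] --> t0.
  have -> : t0 = s0 - n%:~R by rewrite -sn; ring.
  by apply: cvgB => //; exact: cvg_cst.
(* The secant of the curve [K + a W], with the amplitude frozen at [a x]. *)
pose sec x := secant K (s' x) (t x) + a x *: secant W (s' x) (t x).
have csec k : sec x 0 k @[x --> F] --> derive1 K t0 0 k.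
  have -> : derive1 K t0 0 k = derive1 K t0 0 k + 0 * derive1 W t0 0 k by rewrite mul0r addr0.
  under eq_fun do rewrite /sec mxE [X in _ + X]mxE.
  by apply: cvgD; [exact: secant_cvg|apply: cvgM => //; exact: secant_cvg].
have cWt k : W (t x) 0 k @[x --> F] --> W t0 0 k.
  by apply: cvg_coord; apply: cvg_comp_continuous => //; exact: smooth_continuous.
have cdet : det2 (proj (sec x)) (proj (W (t x))) @[x --> F]
    --> det2 (proj (derive1 K t0)) (proj (W t0)).
  by apply: cvg_det2; [exact: csec|exact: csec|exact: cWt|exact: cWt].
near=> x => coinc.
have Dx : det2 (proj (sec x)) (proj (W (t x))) != 0.
  by near: x; exact: cvgr_neq0 cdet D0.
have eK : K (s x) = K (s' x) by rewrite -(closed_curve_int (s' x) n cK) /s' subrK.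
have eW : W (s x) = W (s' x) by rewrite -(closed_curve_int (s' x) n cW) /s' subrK.
have coord k : (K (s x) + a x *: W (s x)) 0 k = (K (t x) + b x *: W (t x)) 0 k ->
    (s' x - t x) * sec x 0 k = (b x - a x) * W (t x) 0 k.
  have /(congr1 (fun v : 'rV[R]_3 => v 0 k)) := secantE K (s' x) (t x).
  have /(congr1 (fun v : 'rV[R]_3 => v 0 k)) := secantE W (s' x) (t x).
  by rewrite eK eW /sec !mxE mulrDr [_ * (a x * _)]mulrCA => <- <- e; lra.
have [e1 e2] : (s' x - t x) * (proj (sec x)).1 = (b x - a x) * (proj (W (t x))).1
    /\ (s' x - t x) * (proj (sec x)).2 = (b x - a x) * (proj (W (t x))).2.
  by case: coinc => h1 h2; split; apply: coord.
have [st ab] := det2_scaled_eq Dx e1 e2.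
split; first by lra.
rewrite sn; move: st; rewrite /s'; lra.
Unshelve. all: by end_near. Qed.

Lemma near_proj_neq (R : realType) (T : Type) (F : set_system T) (FF : Filter F)
    (f g : T -> 'rV[R]_3) (a b : 'rV[R]_3) :
  (forall k, f x 0 k @[x --> F] --> a 0 k) -> (forall k, g x 0 k @[x --> F] --> b 0 k) ->
  proj a <> proj b -> \forall x \near F, proj (f x) <> proj (g x).
Proof.
move=> fa gb ab.
have sep k : a 0 k != b 0 k -> \forall x \near F, f x 0 k != g x 0 k.
  rewrite -subr_eq0 => abk; near=> x; rewrite -subr_eq0; near: x.
  apply: (cvgr_neq0 _ _ abk); exact: cvgB.
have [abx|/sep h] := eqVneq (xcoord a) (xcoord b); last first.
  by apply: filterS h => x /eqP h [].
have [aby|/sep h] := eqVneq (ycoord a) (ycoord b); last first.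
  by apply: filterS h => x /eqP h [].
by case: ab; rewrite /proj abx aby.
Unshelve. all: by end_near. Qed.

Lemma near_neq (R : realType) (T : Type) (F : set_system T) (FF : Filter F)
    (f g : T -> 'rV[R]_3) (a b : 'rV[R]_3) :
  (forall k, f x 0 k @[x --> F] --> a 0 k) -> (forall k, g x 0 k @[x --> F] --> b 0 k) ->
  a <> b -> \forall x \near F, f x <> g x.
Proof.
move=> fa gb ab; have [k abk] : exists k, a 0 k != b 0 k.
  by apply/not_existsP => h; apply: ab; apply/rowP => k; have /negP/negPn/eqP := h k.
near=> x => fg; have : f x 0 k - g x 0 k != 0.
  by near: x; apply: (@cvgr_neq0 _ _ _ _ _ _ (a 0 k - b 0 k)); [exact: cvgB|rewrite subr_eq0].
by rewrite fg subrr eqxx.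
Unshelve. all: by end_near. Qed.

Lemma cvg_curve (R : realType) (T : Type) (F : set_system T) (FF : Filter F)
    (K : R -> 'rV[R]_3) (s : T -> R) (s0 : R) (k : 'I_3) :
  continuous K -> s x @[x --> F] --> s0 -> K (s x) 0 k @[x --> F] --> K s0 0 k.
Proof. by move=> cK ss; apply: cvg_coord; exact: cvg_comp_continuous. Qed.

Lemma smooth_cst (R : realType) (v : 'rV[R]_3) : smooth (fun=> v).
Proof.
have cstn n : exists w, derive1n n (fun _ : R => v) = fun=> w.
  elim: n => [|n [w IH]]; first by exists v.
  by exists 0; rewrite derive1nS IH; apply/funext => t; rewrite derive1_cst.
by move=> n t; have [w ->] := cstn n; exact: derivable_cst.
Qed.

(** This is [near_diagonal_coincidence] with zero amplitudes, along a constant field whose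
    projection is the quarter turn of [proj v]; the determinant is then the squared length of
    [proj v]. *)
Lemma near_immersion_inj (R : realType) (T : Type) (F : set_system T) (FF : Filter F)
    (K : R -> 'rV[R]_3) (s t : T -> R) (s0 t0 : R) :
  smooth K -> closed_curve K -> proj (derive1 K t0) <> (0, 0) -> s0 - t0 \is a Num.int ->
  s x @[x --> F] --> s0 -> t x @[x --> F] --> t0 ->
  \forall x \near F, proj (K (s x)) = proj (K (t x)) -> s x - t x = s0 - t0.
Proof.
move=> sK cK K0 int ss tt; set v := derive1 K t0 in K0.
pose w : 'rV[R]_3 := \row_k (if k == inord 0 then - ycoord v else xcoord v).
have D0 : det2 (proj v) (proj w) != 0.
  rewrite /det2 /= /w /xcoord /ycoord !mxE eqxx -val_eqE /= !inordK //=.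
  rewrite mulrN opprK -!expr2 paddr_eq0 ?sqr_ge0 // !sqrf_eq0.
  by apply/negP => /andP[/eqP h1 /eqP h2]; apply: K0; rewrite /proj /xcoord /ycoord h1 h2.
pose W (u : R) := w; have sW : smooth W by exact: smooth_cst.
have cW : closed_curve W by [].
pose z (x : T) : R := 0; have z0 : z x @[x --> F] --> 0 by exact: cvg_cst.
have near_c := near_diagonal_coincidence FF sK sW cK cW int D0 ss tt z0 z0.
by apply: filterS near_c => x; rewrite !scale0r !addr0 => H /H[].
Qed.

(** [F] consists of the properties shared by all supersets of some finite set. Near [x] the only
    possible point of [B] is [x], so a set containing [x] covers [B] there; compactness yields one
    finite set for all of [A]. *)
Lemma finite_isolated (T : topologicalType) (A B : set T) :
  compact A -> B `<=` A -> (forall x, A x -> \forall y \near x, B y -> y = x) -> finite_set B.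
Proof.
move=> /compact_near_coveringP cA BA iso.
pose F : set_system (set T) := fun P => exists2 D, finite_set D & forall E, D `<=` E -> P E.
have FF : Filter F.
  split=> [|P Q [D fD DP] [E fE EQ]|P Q PQ [D fD DP]].
  - by exists set0.
  - exists (D `|` E); first by rewrite finite_setU.
    by move=> G DEG; split; [apply: DP|apply: EQ] => x ?; apply: DEG; [left|right].
  - by exists D => // E /DP /PQ.
have [x Ax|D fD AD] := cA _ F (fun D x => B x -> D x) FF; last first.
  by apply: sub_finite_set fD => x Bx; apply: (AD D) => //; exact: BA.
exists ([set y | B y -> y = x], [set D | D x]) => /=.
  split; first exact: iso.
  by exists [set x]; [exact: finite_set1|move=> E; apply].
by move=> [y D] /= [yx Dx] /yx ->.
Qed.

(** Crossings are isolated in a compact square. Near a transverse double point the secants of the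
    two curves stay independent, which excludes a second coincidence; near a common point of the
    curves, the last hypothesis leaves no difference of height. *)
Lemma finite_crossings (R : realType) (K1 K2 : R -> 'rV[R]_3) :
  smooth K1 -> smooth K2 ->
  (forall s t, proj (K1 s) = proj (K2 t) -> K1 s <> K2 t ->
     planar_det (derive1 K1 s) (derive1 K2 t) != 0) ->
  (forall s t, K1 s = K2 t -> \forall p \near (s, t),
     proj (K1 p.1) = proj (K2 p.2) -> K1 p.1 = K2 p.2) ->
  finite_set (crossings K1 K2).
Proof.
move=> s1 s2 trans triv; have c1 := smooth_continuous s1; have c2 := smooth_continuous s2.
pose I01 : set R := `[0, 1]%classic.
apply: (@finite_isolated _ (I01 `*` I01)).
- by apply: compact_setX; exact: segment_compact.
- by move=> [s t] [/= /andP[? ?] /andP[? ?] _ _]; rewrite /I01 /= !in_itv /=; split; lra.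
move=> [s0 t0] _.
have cs : p.1 @[p --> (s0, t0)] --> s0 by apply: (@cvg_fst _ _ (nbhs s0) (nbhs t0)).
have ct : p.2 @[p --> (s0, t0)] --> t0 by apply: (@cvg_snd _ _ (nbhs s0) (nbhs t0)).
have [eqp|neqp] := pselect (proj (K1 s0) = proj (K2 t0)); last first.
  have : \forall p \near (s0, t0), proj (K1 p.1) <> proj (K2 p.2).
    apply: (@near_proj_neq R (R * R) (nbhs (s0, t0)) _ (fun p => K1 p.1) (fun p => K2 p.2) (K1 s0) (K2 t0)) => // k;
      exact: cvg_curve.
  by move=> near_p; apply: filterS near_p => p h [].
have [eqK|neqK] := pselect (K1 s0 = K2 t0).
  by apply: filterS (triv _ _ eqK) => p h [_ _ /h -> ]; rewrite ltxx.
have cdet : det2 (proj (secant K1 p.1 s0)) (proj (secant K2 p.2 t0)) @[p --> (s0, t0)]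
    --> det2 (proj (derive1 K1 s0)) (proj (derive1 K2 t0)).
  by apply: cvg_det2; apply: secant_cvg => //; exact: cvg_cst.
near=> p => -[_ _ /= eqs _].
have Dp : det2 (proj (secant K1 p.1 s0)) (proj (secant K2 p.2 t0)) != 0.
  by near: p; apply: (cvgr_neq0 _ cdet); exact: trans.
have coord k : K1 p.1 0 k = K2 p.2 0 k -> K1 s0 0 k = K2 t0 0 k ->
    (p.1 - s0) * secant K1 p.1 s0 0 k = (p.2 - t0) * secant K2 p.2 t0 0 k.
  have /(congr1 (fun v : 'rV[R]_3 => v 0 k)) := secantE K1 p.1 s0.
  have /(congr1 (fun v : 'rV[R]_3 => v 0 k)) := secantE K2 p.2 t0.
  by rewrite !mxE => <- <- -> ->.
have [e1 e2] : (p.1 - s0) * (proj (secant K1 p.1 s0)).1 = (p.2 - t0) * (proj (secant K2 p.2 t0)).1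
  /\ (p.1 - s0) * (proj (secant K1 p.1 s0)).2 = (p.2 - t0) * (proj (secant K2 p.2 t0)).2.
  by have [h3 h4] := eqp; case: eqs => h1 h2; split; apply: coord.
have [/subr0_eq h1 /subr0_eq h2] := det2_scaled_eq Dp e1 e2.
by rewrite -h1 -h2 -surjective_pairing.
Unshelve. all: by end_near. Qed.

(** * Degree near a diagram *)

Lemma near_seq_all (T : Type) (F : set_system T) (FF : Filter F) (I : eqType)
    (z : seq I) (P : I -> T -> Prop) :
  (forall i, i \in z -> \forall x \near F, P i x) ->
  \forall x \near F, forall i, i \in z -> P i x.
Proof.
elim: z => [|j z IH] Pz; first by apply: nearW.
near=> x => i; rewrite inE => /orP[/eqP ->|iz].
  by near: x; apply: Pz; rewrite mem_head.
move: i iz; near: x; apply: IH => i iz; apply: Pz.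
by rewrite inE iz orbT.
Unshelve. all: by end_near. Qed.

(** In projection the difference is [u p - v q] with secants [p], [q] close to the tangents, so the
    right-hand side is about [v^2 D^2]. The bound [|u| <= 2 |v|] absorbs the error in [u]; it holds
    on a frame between radii [r / 2] and [r]. *)
Lemma near_crossing_linear (R : realType) (A B : R -> 'rV[R]_3) (s0 t0 : R) (D : R) :
  smooth A -> smooth B -> proj (A s0) = proj (B t0) ->
  det2 (proj (derive1 A s0)) (proj (derive1 B t0)) = D -> D != 0 ->
  \forall r \near 0^'+, forall u v, `|u| <= r -> `|v| <= r -> `|u| <= 2 * `|v| ->
    v ^+ 2 * (D ^+ 2 / 2) <=
      - v * (D * det2 (proj (derive1 A s0)) (proj (A (s0 + u) - B (t0 + v)))).
Proof.
move=> sA sB eqp eD D0; set a := proj _ in eD *; set b := proj (derive1 B t0) in eD.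
have cu : s0 + w.1 @[w --> ((0 : R), (0 : R))] --> s0.
  rewrite -[X in _ --> X]addr0; apply: cvgD; first exact: cvg_cst.
  by apply: (@cvg_fst _ _ (nbhs (0 : R)) (nbhs (0 : R))).
have cv : t0 + w.2 @[w --> ((0 : R), (0 : R))] --> t0.
  rewrite -[X in _ --> X]addr0; apply: cvgD; first exact: cvg_cst.
  by apply: (@cvg_snd _ _ (nbhs (0 : R)) (nbhs (0 : R))).
have hA k : secant A (s0 + w.1) s0 0 k @[w --> ((0 : R), (0 : R))] --> derive1 A s0 0 k.
  by apply: secant_cvg => //; exact: cvg_cst.
have hB k : secant B (t0 + w.2) t0 0 k @[w --> ((0 : R), (0 : R))] --> derive1 B t0 0 k.
  by apply: secant_cvg => //; exact: cvg_cst.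
have cp : D * det2 a (proj (secant A (s0 + w.1) s0)) @[w --> ((0 : R), (0 : R))] --> 0.
  have aa : D * det2 a a = 0 by rewrite /det2 [a.2 * _]mulrC subrr mulr0.
  rewrite -[X in _ --> X]aa.
  apply: cvgM; first exact: cvg_cst.
  by apply: cvg_det2; [exact: cvg_cst|exact: cvg_cst|exact: hA|exact: hA].
have cq : D * det2 a (proj (secant B (t0 + w.2) t0)) @[w --> ((0 : R), (0 : R))] --> D ^+ 2.
  have DDe : D * det2 a b = D ^+ 2 by rewrite eD expr2.
  rewrite -[X in _ --> X]DDe; apply: cvgM; first exact: cvg_cst.
  by apply: cvg_det2; [exact: cvg_cst|exact: cvg_cst|exact: hB|exact: hB].
have DD : 0 < D ^+ 2 by rewrite exprn_even_gt0.
(* With both errors below [D^2 / 8], and up to the factor [v^2], the term in [u] costs at most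
   [D^2 / 4] and the main term keeps [3 D^2 / 4], which leaves [D^2 / 2]. *)
have D8 : 0 < D ^+ 2 / 8 by rewrite divr_gt0.
have near_w : \forall w \near ((0 : R), (0 : R)), `|w.1| <= 2 * `|w.2| ->
    w.2 ^+ 2 * (D ^+ 2 / 2) <= - w.2 * (D * det2 a (proj (A (s0 + w.1) - B (t0 + w.2)))).
  near=> w => uv.
  have hp : `|D * det2 a (proj (secant A (s0 + w.1) s0))| < D ^+ 2 / 8.
    rewrite -normrN -sub0r; near: w; move/cvgrPdist_lt : cp; exact.
  have hq : `|D ^+ 2 - D * det2 a (proj (secant B (t0 + w.2) t0))| < D ^+ 2 / 8.
    by near: w; move/cvgrPdist_lt : cq; apply.
  set p := D * det2 a _ in hp; set q := D * det2 a _ in hq.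
  have -> : D * det2 a (proj (A (s0 + w.1) - B (t0 + w.2))) = w.1 * p - w.2 * q.
    have [e1 e2] := eqp.
    have coord k : A s0 0 k = B t0 0 k -> (A (s0 + w.1) - B (t0 + w.2)) 0 k =
        w.1 * secant A (s0 + w.1) s0 0 k - w.2 * secant B (t0 + w.2) t0 0 k.
      have /(congr1 (fun v : 'rV[R]_3 => v 0 k)) := secantE A (s0 + w.1) s0.
      have /(congr1 (fun v : 'rV[R]_3 => v 0 k)) := secantE B (t0 + w.2) t0.
      rewrite !mxE ![_ + _ - _]addrAC !subrr !add0r => <- <-; lra.
    rewrite /p /q /det2 /proj /= /xcoord /ycoord !coord //; ring.
  have -> : - w.2 * (w.1 * p - w.2 * q) = w.2 ^+ 2 * q - w.1 * w.2 * p by ring.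
  have b1 : w.1 * w.2 * p <= w.2 ^+ 2 * (D ^+ 2 / 4).
    apply: le_trans (ler_norm _) _; rewrite normrM (normrM w.1).
    have -> : w.2 ^+ 2 * (D ^+ 2 / 4) = (2 * `|w.2|) * `|w.2| * (D ^+ 2 / 8).
      by rewrite -[w.2 ^+ 2]ger0_norm ?sqr_ge0 // normrX; field.
    by apply: ler_pM => //; [apply: ler_pM|exact: ltW].
  have b2 : w.2 ^+ 2 * (D ^+ 2 * (3 / 4)) <= w.2 ^+ 2 * q.
    apply: ler_wpM2l; first exact: sqr_ge0.
    move: hq; rewrite ltr_norml => /andP[_]; lra.
  lra.
have /nbhs_ballP[e /= e0 He] := near_w.
near=> r => u v ur vr uv; apply: (He (u, v)) => //.
have re : r < e by near: r; exact: nbhs_right_lt.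
by split; rewrite /ball /= sub0r normrN; apply: le_lt_trans re.
Unshelve. all: by end_near. Qed.

(** Crossings of [A] over [B] and under [B] alike: the projected difference vanishes at both,
    although only the former contribute to the degree. *)
Definition double_points (R : realType) (A B : R -> 'rV[R]_3) : set (R * R) :=
  [set p | [/\ 0 <= p.1 < 1, 0 <= p.2 < 1, proj (A p.1) = proj (B p.2) & A p.1 <> B p.2]].

Lemma row3_eq (R : realType) (a b : 'rV[R]_3) :
  proj a = proj b -> height a = height b -> a = b.
Proof.
move=> [xe ye] ze; apply/eqP; rewrite -subr_eq0; apply/negPn/negP => /row3_neq0.
rewrite /xcoord /ycoord /height !mxE.
by case; rewrite subr_eq0 => /eqP; apply.
Qed.

Lemma finite_double_points (R : realType) (A B : R -> 'rV[R]_3) :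
  finite_set (crossings A B) -> finite_set (crossings B A) -> finite_set (double_points A B).
Proof.
move=> fAB fBA; pose swap (p : R * R) := (p.2, p.1).
apply: (@sub_finite_set _ _ (crossings A B `|` swap @` crossings B A)); last first.
  by rewrite finite_setU; split => //; exact: finite_image.
move=> [s t] [/= s01 t01 eqp neq].
have [h|h|h] := ltgtP (height (A s)) (height (B t)).
- by right; exists (t, s).
- by left.
- by case: neq; exact: row3_eq.
Qed.

Lemma sign_sumE (R : realType) (A B : R -> 'rV[R]_3) (Z : seq (R * R)) :
  uniq Z -> (forall p, p \in Z <-> double_points A B p) ->
  sign_sum A B = \sum_(p <- Z | height (B p.2) < height (A p.1)) crossing_sign A B p.
Proof.
move=> uZ memZ; rewrite /sign_sum.
have -> : crossings A B = [set` Z] `&` [set p | height (B p.2) < height (A p.1)].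
  apply/seteqP; split=> p; first by case=> h1 h2 h3 h4; split=> //; apply/memZ; split => // e;
    rewrite e ltxx in h4.
  by case=> /memZ[h1 h2 h3 _] h4.
rewrite fsbig_mkcondr -fsbig_seq //= [RHS]big_mkcond /=.
by apply: eq_bigr => p _; case: ifP => [/set_mem -> //|/negbT/negP h]; case: ifP => // h'; case: h; apply/mem_set.
Qed.

(** The constants are fixed by [A] and [B] before [G]. A perturbation [G] is allowed because for
    [A = B] the exact difference vanishes on the diagonal; for the same reason closeness alone
    cannot keep the projection of [G] away from 0, and this is a separate hypothesis. The window
    starts at [- e] so that double points with parameter 0 become interior, and [p + e < 1] keeps
    the others inside. *)
Lemma degree_near_diagram (R : realType) (A B : R -> 'rV[R]_3) :
  smooth A -> smooth B -> finite_set (double_points A B) ->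
  (forall s t, proj (A s) = proj (B t) -> A s <> B t ->
     planar_det (derive1 A s) (derive1 B t) != 0) ->
  exists e d k : R, [/\ 0 < e, 0 < d, 0 < k,
    forall p, double_points A B p -> p.1 + e < 1 /\ p.2 + e < 1 &
    forall G : R -> R -> 'rV[R]_3, continuous (fun q : R * R => G q.1 q.2) ->
      (forall s t i, - e <= s <= 1 - e -> - e <= t <= 1 - e ->
         `|G s t 0 i - (A s - B t) 0 i| < k) ->
      (forall s t, - e <= s <= 1 - e -> - e <= t <= 1 - e ->
         (forall p, double_points A B p -> ~ (`|s - p.1| < d /\ `|t - p.2| < d)) ->
         proj (G s t) <> (0, 0)) ->
      \forall N \near \oo, degree N (fun s t => G (s - e) (t - e)) = - sign_sum A B].
Proof.
move=> sA sB fS trans; set S := double_points A B in fS *.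
have [Z0 [uZ SZ]] : exists Z0 : seq (R * R), uniq Z0 /\ forall p, p \in Z0 <-> S p.
  have [z Sz] := (finite_seqP S).1 fS; exists (undup z); split; first exact: undup_uniq.
  by move=> p; rewrite mem_undup Sz.
have memZ p : p \in Z0 -> S p by move/SZ.
have Zmem p : S p -> p \in Z0 by move/SZ.
have [e [e0 eS]] : exists e : R, 0 < e /\ forall p, p \in Z0 -> p.1 + e < 1 /\ p.2 + e < 1.
  have : \forall e \near (0 : R)^'+, forall p, p \in Z0 -> p.1 + e < 1 /\ p.2 + e < 1.
    apply: near_seq_all => p /memZ[/andP[_ p1] /andP[_ p2] _ _].
    near=> e; split; rewrite -ltrBrDl; near: e; apply: nbhs_right_lt; rewrite subr_gt0 //.
  by move=> /(filterI (nbhs_right_gt (0 : R))) /filter_ex[e [? ?]]; exists e.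
pose D (p : R * R) := planar_det (derive1 A p.1) (derive1 B p.2).
have D0 p : p \in Z0 -> D p != 0 by move=> /memZ[_ _ ? ?]; exact: trans.
pose h (s t : R) := height (A s - B t).
have h0 p : p \in Z0 -> h p.1 p.2 != 0.
  move=> /memZ[_ _ pe pN]; apply/eqP => hp; apply: pN; apply: row3_eq => //.
  by apply/eqP; rewrite -subr_eq0 -hp /h /height !mxE.
have hcont p : h (p.1 + w.1) (p.2 + w.2) @[w --> ((0 : R), (0 : R))] --> h p.1 p.2.
  rewrite /h /height; under eq_fun do rewrite !mxE.
  rewrite !mxE; apply: cvgB; apply: cvg_curve; try exact: smooth_continuous;
    rewrite -[X in _ --> X]addr0; apply: cvgD; try exact: cvg_cst.
  - by apply: (@cvg_fst _ _ (nbhs (0 : R)) (nbhs (0 : R))).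
  - by apply: (@cvg_snd _ _ (nbhs (0 : R)) (nbhs (0 : R))).
have near_bound : \forall r \near (0 : R)^'+, forall p, p \in Z0 ->
    p.1 + e + r < 1 /\ p.2 + e + r < 1.
  apply: near_seq_all => p /eS[p1 p2].
  by near=> r; split; rewrite -ltrBrDl; near: r; apply: nbhs_right_lt; rewrite subr_gt0.
have near_disj : \forall r \near (0 : R)^'+, forall p, p \in Z0 -> forall p', p' \in Z0 ->
    p != p' -> ~ (`|p.1 - p'.1| <= 2 * r /\ `|p.2 - p'.2| <= 2 * r).
  apply: near_seq_all => p pZ; apply: near_seq_all => p' p'Z.
  case: (eqVneq p p') => [_|pp']; first by near=> r.
  have [n1|n1] := eqVneq p.1 p'.1; last first.
    near=> r => _ [+ _]; apply/negP; rewrite -ltNge mulrC -ltr_pdivlMr //.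
    by near: r; apply: nbhs_right_lt; rewrite divr_gt0 // normr_gt0 subr_eq0.
  have n2 : p.2 != p'.2.
    by apply: contra pp' => /eqP n2; rewrite (surjective_pairing p) n1 n2 -surjective_pairing.
  near=> r => _ [_]; apply/negP; rewrite -ltNge mulrC -ltr_pdivlMr //.
  by near: r; apply: nbhs_right_lt; rewrite divr_gt0 // normr_gt0 subr_eq0.
have near_hor : \forall r \near (0 : R)^'+, forall p, p \in Z0 ->
    forall u v, `|u| <= r -> `|v| <= r -> `|u| <= 2 * `|v| ->
    v ^+ 2 * (D p ^+ 2 / 2) <= - v * (D p *
      det2 (proj (derive1 A p.1)) (proj (A (p.1 + u) - B (p.2 + v)))).
  apply: near_seq_all => p pZ; have [_ _ pe _] := memZ _ pZ.
  by apply: near_crossing_linear => //; exact: D0.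
(* The same estimate with the two curves exchanged, which changes the sign of the determinant. *)
have near_ver : \forall r \near (0 : R)^'+, forall p, p \in Z0 ->
    forall v u, `|v| <= r -> `|u| <= r -> `|v| <= 2 * `|u| ->
    u ^+ 2 * ((- D p) ^+ 2 / 2) <= - u * (- D p *
      det2 (proj (derive1 B p.2)) (proj (B (p.2 + v) - A (p.1 + u)))).
  apply: near_seq_all => p pZ; have [_ _ pe _] := memZ _ pZ.
  apply: near_crossing_linear => //; last by rewrite oppr_eq0; exact: D0.
  by rewrite /D /planar_det /det2 /=; ring.
have near_h : \forall r \near (0 : R)^'+, forall p, p \in Z0 ->
    forall u v, `|u| <= r -> `|v| <= r ->
    `|h p.1 p.2 - h (p.1 + u) (p.2 + v)| < `|h p.1 p.2| / 2.
  apply: near_seq_all => p pZ.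
  have hp2 : 0 < `|h p.1 p.2| / 2 by rewrite divr_gt0 // normr_gt0; exact: h0.
  have /cvgrPdist_lt /(_ _ hp2) /nbhs_ballP[x /= x0 Hx] := hcont p.
  near=> r => u v ur vr; apply: (Hx (u, v)).
  have rx : r < x by near: r; exact: nbhs_right_lt.
  by split; rewrite /ball /= sub0r normrN; apply: le_lt_trans rx.
have [r [r0 [re [rr [rdisj [rhor [rver rh]]]]]]] :=
  filter_ex (filterI (nbhs_right_gt (0 : R)) (filterI (nbhs_right_lt e0)
    (filterI near_bound (filterI near_disj (filterI near_hor (filterI near_ver near_h)))))).
pose M (v : R * R) : R := `|v.1| + `|v.2|.
have M0 v : 0 <= M v by rewrite addr_ge0.
have small (c x : R) : 0 <= c -> 0 < x -> \forall k \near (0 : R)^'+, c * k < x.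
  move=> c0 x0; near=> k; apply: (@le_lt_trans _ _ ((c + 1) * k)).
    by apply: ler_wpM2r; [near: k; exact: nbhs_right_ge|rewrite lerDl].
  rewrite mulrC -ltr_pdivlMr; last by rewrite ltr_wpDl.
  by near: k; apply: nbhs_right_lt; rewrite divr_gt0 // ltr_wpDl.
(* Replacing the exact difference by [G] moves [det2 a] by at most [M a * k]. To preserve the sign
   given by the bound [v^2 D^2 / 2], this must stay below [|v| |D| / 2], where [|v|] is at least
   [r / 2]. *)
have Dpos p : p \in Z0 -> 0 < r / 2 * `|D p| / 2.
  by move=> /D0 Dp; rewrite !divr_gt0 // mulr_gt0 ?divr_gt0 ?normr_gt0.
have near_kA : \forall k \near (0 : R)^'+, forall p, p \in Z0 ->
    M (proj (derive1 A p.1)) * k < r / 2 * `|D p| / 2.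
  by apply: near_seq_all => p pZ; apply: small => //; exact: Dpos.
have near_kB : \forall k \near (0 : R)^'+, forall p, p \in Z0 ->
    M (proj (derive1 B p.2)) * k < r / 2 * `|D p| / 2.
  by apply: near_seq_all => p pZ; apply: small => //; exact: Dpos.
have near_kh : \forall k \near (0 : R)^'+, forall p, p \in Z0 -> k < `|h p.1 p.2| / 2.
  apply: near_seq_all => p pZ; apply: nbhs_right_lt.
  by rewrite divr_gt0 // normr_gt0; exact: h0.
have [k [k0 [kA [kB kh]]]] :=
  filter_ex (filterI (nbhs_right_gt (0 : R)) (filterI near_kA (filterI near_kB near_kh))).
exists e, (r / 2), k; split => //; first by rewrite divr_gt0.
  by move=> p /Zmem /eS.
move=> G cG Gk Gout.
pose sh (p : R * R) := (p.1 + e, p.2 + e).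
pose al (q : R * R) := proj (derive1 A (q.1 - e)); pose be (q : R * R) := proj (derive1 B (q.2 - e)).
pose up q := height (B (q.2 - e)) < height (A (q.1 - e)).
have -> : - sign_sum A B = - \sum_(q <- map sh Z0 | up q) sgz (det2 (al q) (be q)).
  rewrite big_map (sign_sumE uZ SZ); congr (- _).
  by apply: eq_big => p; rewrite /up /al /be /= !addrK.
have inI y u : 0 <= y -> y + e + r < 1 -> `|u| <= r -> - e <= y + u <= 1 - e.
  clear -r0 re => y0 y1; rewrite ler_norml => /andP[u1 u2]; apply/andP; split; lra.
have gap p u v : p \in Z0 -> `|u| <= r -> `|v| <= r -> forall i,
    `|G (p.1 + u) (p.2 + v) 0 i - (A (p.1 + u) - B (p.2 + v)) 0 i| < k.
  move=> pZ ur vr i; have [/andP[? _] /andP[? _] _ _] := memZ _ pZ; have [? ?] := rr _ pZ.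
  by apply: Gk; apply: inI.
have dist_det (a : R * R) (X Y : 'rV[R]_3) : (forall i, `|X 0 i - Y 0 i| < k) ->
    `|det2 a (proj X) - det2 a (proj Y)| <= M a * k.
  move=> XY; have -> : det2 a (proj X) - det2 a (proj Y) =
      a.1 * (ycoord X - ycoord Y) - a.2 * (xcoord X - xcoord Y).
    by rewrite /det2 /=; ring.
  apply: le_trans (ler_normB _ _) _; rewrite !normrM mulrDl.
  by apply: lerD; (apply: ler_wpM2l => //; apply: ltW; exact: XY).
have stable (v d x y c : R) : r / 2 <= `|v| -> d != 0 -> `|x - y| <= c ->
    c < r / 2 * `|d| / 2 -> v ^+ 2 * (d ^+ 2 / 2) <= - v * (d * y) -> 0 < - v * (d * x).
  clear -r0 => vr d0 xy cr hy.
  have dpos : 0 < `|d| by rewrite normr_gt0.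
  have vpos : 0 < `|v| by apply: lt_le_trans vr; rewrite divr_gt0.
  have : v * d * (x - y) < v ^+ 2 * (d ^+ 2 / 2).
    apply: le_lt_trans (ler_norm _) _; rewrite !normrM.
    have -> : v ^+ 2 * (d ^+ 2 / 2) = `|v| * `|d| * (`|v| * `|d| / 2).
      have -> : v ^+ 2 = `|v| ^+ 2 by rewrite real_normK // num_real.
      have -> : d ^+ 2 = `|d| ^+ 2 by rewrite real_normK // num_real.
      by field.
    rewrite ltr_pM2l ?mulr_gt0 //; apply: le_lt_trans xy _; apply: lt_le_trans cr _.
    by rewrite ler_pM2r ?invr_gt0 // ler_pM2r.
  have -> : - v * (d * x) = - v * (d * y) - v * d * (x - y) by ring.
  lra.
apply: (@degree_localize _ _ _ _ _ _ (r / 2) r).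
- move=> q; apply: (@cvg_comp2_continuous _ _ _ _ _ _ (fun q : R * R => G q.1 q.2)
    (fun q : R * R => q.1 - e) (fun q : R * R => q.2 - e)) => //.
    by apply: cvgB; [exact: cvg_fst|exact: cvg_cst].
  by apply: cvgB; [exact: cvg_snd|exact: cvg_cst].
- rewrite map_inj_uniq // => -[p1 p2] [q1 q2] [/addIr -> /addIr ->] //.
- by clear -r0; apply/andP; split; lra.
- move=> _ /mapP[p pZ ->] /=.
  have [/andP[p1 _] /andP[p2 _] _ _] := memZ _ pZ; have [? ?] := rr _ pZ.
  by split=> //; rewrite ltr_wpDl.
- move=> _ _ s t /mapP[p pZ ->] /mapP[p' p'Z ->] /= h1 h2 h3 h4.
  have [-> //|pp'] := eqVneq p p'.
  case: (rdisj p pZ p' p'Z pp'); rewrite !ler_norml.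
  move: h1 h2 h3 h4; rewrite !ler_norml.
  clear => /andP[? ?] /andP[? ?] /andP[? ?] /andP[? ?].
  by split; apply/andP; split; lra.
- by move=> _ /mapP[p pZ ->]; rewrite /al /be /= !addrK; exact: D0.
- move=> _ u v /mapP[p pZ ->] ur /andP[v1 v2]; rewrite /al /be /= !addrK.
  rewrite [p.1 + e + u - e]addrAC [p.2 + e + v - e]addrAC !addrK.
  have uv : `|u| <= 2 * `|v| by clear -ur v1; lra.
  apply: (stable _ _ _ _ _ v1 (D0 p pZ) (dist_det _ _ _ (gap _ _ _ pZ ur v2)) (kA _ pZ)).
  exact: rhor.
- move=> _ u v /mapP[p pZ ->] vr /andP[u1 u2]; rewrite /al /be /= !addrK.
  rewrite [p.1 + e + u - e]addrAC [p.2 + e + v - e]addrAC !addrK.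
  have vu : `|v| <= 2 * `|u| by clear -vr u1; lra.
  have D0' : - D p != 0 by rewrite oppr_eq0; exact: D0.
  have kB' := kB _ pZ; rewrite -normrN in kB'.
  have hy := rver _ pZ _ _ vr u2 vu.
  have e1 : det2 (proj (derive1 B p.2)) (proj (B (p.2 + v) - A (p.1 + u)))
      = - det2 (proj (derive1 B p.2)) (proj (A (p.1 + u) - B (p.2 + v))).
    by rewrite /det2 /= /xcoord /ycoord !mxE; ring.
  have hx : `|- det2 (proj (derive1 B p.2)) (proj (G (p.1 + u) (p.2 + v)))
     - det2 (proj (derive1 B p.2)) (proj (B (p.2 + v) - A (p.1 + u)))|
     <= M (proj (derive1 B p.2)) * k.
    by rewrite e1 opprK addrC distrC; apply: dist_det; exact: gap.
  have := stable _ _ _ _ _ u1 D0' hx kB' hy.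
  congr (0 < _); rewrite /D /planar_det /det2 /=; ring.
- move=> _ u v /mapP[p pZ ->] ur vr; rewrite /up /= !addrK.
  rewrite [p.1 + e + u - e]addrAC [p.2 + e + v - e]addrAC !addrK.
  have -> : (height (B p.2) < height (A p.1)) = (0 < h p.1 p.2).
    by rewrite /h /height !mxE subr_gt0.
  have := rh _ pZ _ _ ur vr; have := gap _ _ _ pZ ur vr (inord 2); have := kh _ pZ.
  rewrite -/(height (G _ _)) -/(height (A _ - B _)) -/(h _ _).
  have := h0 _ pZ; set x := h p.1 p.2; set y := h _ _; set z := height _.
  clear -x y z; case: (ltrgtP 0 x) => // hx _.
    rewrite gtr0_norm // !ltr_norml => k1 /andP[? ?] /andP[? ?]; lra.
  rewrite ltr0_norm // !ltr_norml => k1 /andP[? ?] /andP[? ?].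
  by apply/negbTE; rewrite -leNgt; lra.
move=> s t s01 t01 nb; apply: Gout.
- by clear -s01; move/andP: s01 => [? ?]; apply/andP; split; lra.
- by clear -t01; move/andP: t01 => [? ?]; apply/andP; split; lra.
move=> p Sp [p1 p2]; apply: (nb (sh p)); first by apply: map_f; exact: Zmem.
by rewrite /= ![_ + e]addrC !opprD !addrA.
Unshelve. all: by end_near. Qed.

(** * Blackboard framings *)

Lemma near_bool_all (T : Type) (F : set_system T) (FF : Filter F) (P : bool -> T -> Prop) :
  (forall b, \forall x \near F, P b x) -> \forall x \near F, forall b, P b x.
Proof. by move=> H; near=> x; case; near: x; exact: H. Unshelve. all: by end_near. Qed.

Lemma unit_representative (R : realType) (t : R) : exists n : int, 0 <= t - n%:~R < 1.
Proof.
exists (Num.floor t); have /andP[h1 h2] := floor_itv t.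
by rewrite intrD in h2; apply/andP; split; lra.
Qed.

Lemma closed_curveB_int (R : realType) (f : R -> 'rV[R]_3) (t : R) (n : int) :
  closed_curve f -> f (t - n%:~R) = f t.
Proof. by move=> fc; rewrite -[RHS](closed_curve_int _ (- n)) // mulrNz. Qed.

Lemma double_points_window (R : realType) (A B : R -> 'rV[R]_3) (e s t : R) :
  closed_curve A -> closed_curve B ->
  (forall p, double_points A B p -> p.1 + e < 1 /\ p.2 + e < 1) ->
  0 < e -> - e <= s <= 1 - e -> - e <= t <= 1 - e ->
  proj (A s) = proj (B t) -> A s <> B t -> double_points A B (s, t).
Proof.
move=> cA cB He e0 se te eqp neq.
have [n sn] := unit_representative s; have [m tm] := unit_representative t.
have Sp : double_points A B (s - n%:~R, t - m%:~R).
  by split; rewrite //= !closed_curveB_int.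
have zero (y : R) (k : int) : - e <= y <= 1 - e -> 0 <= y - k%:~R < 1 -> y - k%:~R + e < 1 -> k = 0.
  move=> /andP[? ?] /andP[? ?] ?.
  have : (-1)%:~R < k%:~R :> R by rewrite mulrN1z; lra.
  have : k%:~R < 1%:~R :> R by rewrite mulr1z; lra.
  by rewrite !ltr_int; clear => h1 h2; lia.
have [/= /(zero _ _ se sn) n0 /(zero _ _ te tm) m0] := He _ Sp.
by move: Sp; rewrite n0 m0 !subr0.
Qed.

Lemma coord_le_norm (R : realType) (v : 'rV[R]_3) (k : 'I_3) : `|v 0 k| <= `|v|.
Proof. by rewrite [leRHS]/Num.Def.normr /= mx_normrE; exact: (le_bigmax _ _ (0, k)). Qed.

(* A horizontal normal field is transverse to the projected tangent: both are nonzero and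
   they are orthogonal in the plane. *)
Lemma blackboard_transverse (R : realType) (K V : R -> 'rV[R]_3) (t : R) :
  proj (derive1 K t) <> (0, 0) -> blackboard_framing K V ->
  det2 (proj (derive1 K t)) (proj (V t)) != 0.
Proof.
move=> K0 [[_ _ V0 VK] Vh]; set k := derive1 K t in K0 *.
have dotE : xcoord (V t) * xcoord k + ycoord (V t) * ycoord k = 0.
  have := VK t; rewrite /dot !big_ord_recl big_ord0 addr0 -/k.
  have -> : ord0 = inord 0 :> 'I_3 by apply: val_inj; rewrite /= inordK.
  have -> : lift (inord 0) ord0 = inord 1 :> 'I_3.
    by apply: val_inj; rewrite /= /bump !inordK.
  set i2 := lift _ _.
  have -> : i2 = inord 2 :> 'I_3 by apply: val_inj; rewrite /= /bump !inordK.
  by have := Vh t; rewrite /height => ->; rewrite mul0r addr0.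
have knz : xcoord k ^+ 2 + ycoord k ^+ 2 != 0.
  rewrite paddr_eq0 ?sqr_ge0 // !sqrf_eq0; apply/negP => /andP[/eqP h1 /eqP h2].
  by apply: K0; rewrite /proj h1 h2.
apply/negP => /eqP d0; have {d0} : xcoord k * ycoord (V t) - ycoord k * xcoord (V t) = 0 by [].
move=> d0.
have vx : (xcoord k ^+ 2 + ycoord k ^+ 2) * xcoord (V t) = 0.
  transitivity (xcoord k * (xcoord (V t) * xcoord k + ycoord (V t) * ycoord k)
    - ycoord k * (xcoord k * ycoord (V t) - ycoord k * xcoord (V t))); first by ring.
  by rewrite dotE d0 !mulr0 subrr.
have vy : (xcoord k ^+ 2 + ycoord k ^+ 2) * ycoord (V t) = 0.
  transitivity (ycoord k * (xcoord (V t) * xcoord k + ycoord (V t) * ycoord k)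
    + xcoord k * (xcoord k * ycoord (V t) - ycoord k * xcoord (V t))); first by ring.
  by rewrite dotE d0 !mulr0 addr0.
have /row3_neq0[] := V0 t.
- by move/eqP: vx; rewrite mulf_eq0 (negPf knz) /= => ->.
- by move/eqP: vy; rewrite mulf_eq0 (negPf knz) /= => ->.
by rewrite Vh eqxx.
Qed.

(** By the triangle inequality [g d t] bounds from below the absolute determinant of the tangent
    with any vector within [d] of [V t]. It is positive at [d = 0] by [blackboard_transverse], hence
    for small [d] uniformly over a period. *)
Lemma near_framing_transverse (R : realType) (K V : R -> 'rV[R]_3) :
  knot_diagram K -> blackboard_framing K V ->
  exists2 d : R, 0 < d & forall W : R -> 'rV[R]_3, (forall t, `|W t - V t| < d) ->
    forall t, det2 (proj (derive1 K t)) (proj (W t)) != 0.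
Proof.
move=> hD hV; have [[Kknot _] imm _ _ _] := hD; have {}Kknot := Kknot tt.
have [Kc sK _ _] := Kknot; have [[Vc Vcont _ _] _] := hV.
pose g (d t : R) : R := `|det2 (proj (derive1 K t)) (proj (V t))|
  - (`|xcoord (derive1 K t)| + `|ycoord (derive1 K t)|) * d.
have near_d : \forall d \near (0 : R)^'+, forall t, `[0, 1]%classic t -> 0 < g d t.
  have /compact_near_coveringP := @segment_compact R 0 1.
  apply=> t0 _.
  pose F := filter_prod (nbhs t0) (0 : R)^'+.
  have ct : z.1 @[z --> F] --> t0 by exact: cvg_fst.
  have cd : z.2 @[z --> F] --> (0 : R).
    apply: (@cvg_trans _ (id x @[x --> (0 : R)^'+])); first exact: cvg_snd.
    by apply: cvg_at_right_filter; exact: cvg_id.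
  have cg : g z.2 z.1 @[z --> F] --> g 0 t0.
    have cK k : derive1 K z.1 0 k @[z --> F] --> derive1 K t0 0 k.
      by apply: cvg_curve => //; exact: smooth_continuous1.
    have cV k : V z.1 0 k @[z --> F] --> V t0 0 k by apply: cvg_curve.
    apply: cvgB.
      apply: cvg_norm; apply: cvg_det2; [exact: cK|exact: cK|exact: cV|exact: cV].
    by apply: cvgM => //; apply: cvgD; apply: cvg_norm; exact: cK.
  apply: (cvgr_gt _ cg); rewrite /g mulr0 subr0 normr_gt0.
  by apply: blackboard_transverse => //; exact: (imm tt).
have [d [d0 Hd]] := filter_ex (filterI (nbhs_right_gt (0 : R)) near_d).
exists d => // W WV t; apply/negP => /eqP W0.
have gt : 0 < g d t.
  have [n tn] := unit_representative t.
  have -> : g d t = g d (t - n%:~R).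
    by rewrite /g !closed_curveB_int //; exact: closed_curve_derive1.
  by apply: Hd; rewrite /= in_itv /=; move/andP: tn => [-> /ltW ->].
have e1 : det2 (proj (derive1 K t)) (proj (V t)) = 
   ycoord (derive1 K t) * xcoord (W t - V t) - xcoord (derive1 K t) * ycoord (W t - V t).
  rewrite -[LHS]subr0 -W0 /det2 /= /xcoord /ycoord !mxE; ring.
move: gt; rewrite /g e1 subr_gt0; apply/negP; rewrite -leNgt.
apply: le_trans (ler_normB _ _) _; rewrite !normrM mulrDl addrC.
by apply: lerD; apply: ler_wpM2l => //; apply: le_trans (coord_le_norm _ _) _; exact: ltW.
Qed.

(** * Small push-offs *)

(** As in [pair_link], [true] indexes [K]. One formula for both components lets a single statement
    cover self-crossings and mutual crossings. *)
Definition pushoff (R : realType) (K W : R -> 'rV[R]_3) (e : R) (b : bool) : R -> 'rV[R]_3 :=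
  fun t => K t + (if b then 0 else e) *: W t.

Lemma pair_link_shift (R : realType) (K W : R -> 'rV[R]_3) (e : R) :
  pair_link K (Defs.shift K W e) = pushoff K W e.
Proof.
apply/funext => -[]; apply/funext => t; rewrite /pair_link /pushoff //.
by rewrite scale0r addr0.
Qed.

Lemma pushoff_closed (R : realType) (K W : R -> 'rV[R]_3) (e : R) (b : bool) :
  closed_curve K -> closed_curve W -> closed_curve (pushoff K W e b).
Proof. by move=> cK cW t; rewrite /pushoff cK cW. Qed.

Lemma derive1n_pushoff (R : realType) (K W : R -> 'rV[R]_3) (e : R) (b : bool) (n : nat) :
  smooth K -> smooth W ->
  derive1n n (pushoff K W e b) = pushoff (derive1n n K) (derive1n n W) e b.
Proof.
move=> sK sW; elim: n => [//|n IH]; rewrite !derive1nS IH; apply/funext => t.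
rewrite derive1E /pushoff deriveD; last 2 first.
- exact: sK.
- by apply: derivableZ; exact: sW.
by rewrite deriveZ ?derive1E //; exact: sW.
Qed.

Lemma pushoff_smooth (R : realType) (K W : R -> 'rV[R]_3) (e : R) (b : bool) :
  smooth K -> smooth W -> smooth (pushoff K W e b).
Proof.
move=> sK sW n t; rewrite derive1n_pushoff //; apply: derivableD; first exact: sK.
by apply: derivableZ; exact: sW.
Qed.

Lemma derive1_pushoff (R : realType) (K W : R -> 'rV[R]_3) (e : R) (b : bool) :
  smooth K -> smooth W -> derive1 (pushoff K W e b) = pushoff (derive1 K) (derive1 W) e b.
Proof. exact: (@derive1n_pushoff _ K W e b 1). Qed.

Lemma cvg_pushoff (R : realType) (T : Type) (F : set_system T) (FF : Filter F)
    (K W : R -> 'rV[R]_3) (s e : T -> R) (s0 : R) (b : bool) (k : 'I_3) :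
  continuous K -> continuous W -> s x @[x --> F] --> s0 -> e x @[x --> F] --> 0 ->
  pushoff K W (e x) b (s x) 0 k @[x --> F] --> K s0 0 k.
Proof.
move=> cK cW ss ee; rewrite /pushoff; under eq_fun do rewrite mxE [X in _ + X]mxE.
have -> : K s0 0 k = K s0 0 k + 0 * W s0 0 k by rewrite mul0r addr0.
apply: cvgD; first exact: cvg_curve.
by apply: cvgM; [case: b => //; exact: cvg_cst|exact: cvg_curve].
Qed.

(** A coincidence near the diagonal forces equal amplitudes, and since [e] is positive this means
    the same component. *)
Lemma near_pushoff_diagonal (R : realType) (T : Type) (F : set_system T) (FF : Filter F)
    (K W : R -> 'rV[R]_3) (s t e : T -> R) (s0 t0 : R) :
  smooth K -> smooth W -> closed_curve K -> closed_curve W ->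
  s0 - t0 \is a Num.int -> det2 (proj (derive1 K t0)) (proj (W t0)) != 0 ->
  s x @[x --> F] --> s0 -> t x @[x --> F] --> t0 -> e x @[x --> F] --> 0 ->
  (\forall x \near F, 0 < e x) ->
  \forall x \near F, forall i j,
    proj (pushoff K W (e x) i (s x)) = proj (pushoff K W (e x) j (t x)) ->
    i = j /\ s x - t x \is a Num.int.
Proof.
move=> sK sW cK cW int D0 ss tt ee epos.
apply: near_bool_all => i; apply: near_bool_all => j.
have cc (b : bool) : (if b then 0 else e x) @[x --> F] --> (0 : R).
  by case: b => //; exact: cvg_cst.
have near_c := near_diagonal_coincidence FF sK sW cK cW int D0 ss tt (cc i) (cc j).
near=> x => coinc.
have [eij est] : (if i then 0 else e x) = (if j then 0 else e x) /\ s x - t x = s0 - t0.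
  by move: coinc; near: x; exact: near_c.
have e0 : 0 < e x by near: x.
split; last by rewrite est.
by case: (i) (j) eij => -[] // h; move: e0; rewrite ?h -?h ltxx.
Unshelve. all: by end_near. Qed.


(** The alternative carries injectivity, disjointness and transversality at once. Around a limit
    pair on the diagonal modulo 1 the first outcome holds; around a crossing of [K] transversality
    is an open condition; elsewhere the projections stay apart. *)
Lemma near_pushoff_crossing (R : realType) (K W : R -> 'rV[R]_3) :
  knot_diagram K -> smooth W -> closed_curve W ->
  (forall t, det2 (proj (derive1 K t)) (proj (W t)) != 0) ->
  \forall e \near (0 : R)^'+, forall s t i j,
    proj (pushoff K W e i s) = proj (pushoff K W e j t) ->
    (i = j /\ s - t \is a Num.int) \/
    (pushoff K W e i s <> pushoff K W e j t /\
     planar_det (derive1 (pushoff K W e i) s) (derive1 (pushoff K W e j) t) != 0).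
Proof.
move=> [[Kknot _] imm trans _ _] sW cW D0; have {Kknot}[cK sK _ injK] := Kknot tt.
pose I01 : set R := `[0, 1]%classic.
have near_e : \forall e \near (0 : R)^'+, forall p, (I01 `*` I01) p -> forall i j,
    proj (pushoff K W e i p.1) = proj (pushoff K W e j p.2) ->
    (i = j /\ p.1 - p.2 \is a Num.int) \/
    (pushoff K W e i p.1 <> pushoff K W e j p.2 /\
     planar_det (derive1 (pushoff K W e i) p.1) (derive1 (pushoff K W e j) p.2) != 0).
  have /compact_near_coveringP cI : compact (I01 `*` I01).
    by apply: compact_setX; exact: segment_compact.
  apply: (cI _ (0 : R)^'+ (fun e p => forall i j,
    proj (pushoff K W e i p.1) = proj (pushoff K W e j p.2) -> _ \/ _)) => -[s0 t0] _.
  pose F := filter_prod (nbhs (s0, t0)) (0 : R)^'+.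
  have FF : Filter F by exact: filter_prod_filter.
  have cs : z.1.1 @[z --> F] --> s0.
    apply: (@cvg_comp _ _ _ fst fst _ (nbhs (s0, t0))); first exact: cvg_fst.
    by apply: (@cvg_fst _ _ (nbhs s0) (nbhs t0)).
  have ct : z.1.2 @[z --> F] --> t0.
    apply: (@cvg_comp _ _ _ fst snd _ (nbhs (s0, t0))); first exact: cvg_fst.
    by apply: (@cvg_snd _ _ (nbhs s0) (nbhs t0)).
  have ce : z.2 @[z --> F] --> (0 : R).
    apply: (@cvg_trans _ (id x @[x --> (0 : R)^'+])); first exact: cvg_snd.
    by apply: cvg_at_right_filter; exact: cvg_id.
  have epos : \forall z \near F, 0 < z.2.
    exists (setT, [set e : R | 0 < e]); last by move=> [? ?] [].
    by split; [exact: filterT|exact: nbhs_right_gt].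
  pose Q i j (z : (R * R) * R) :=
    proj (pushoff K W z.2 i z.1.1) = proj (pushoff K W z.2 j z.1.2) ->
    (i = j /\ z.1.1 - z.1.2 \is a Num.int) \/
    (pushoff K W z.2 i z.1.1 <> pushoff K W z.2 j z.1.2 /\
     planar_det (derive1 (pushoff K W z.2 i) z.1.1) (derive1 (pushoff K W z.2 j) z.1.2) != 0).
  suff nearQ : forall i j, \forall z \near F, Q i j z.
    have nearQ' : \forall z \near F, forall i j, Q i j z.
      by apply: near_bool_all => i; apply: near_bool_all => j; exact: nearQ.
    exact: nearQ'.
  move=> i j.
  have [int|nint] := pselect (s0 - t0 \is a Num.int).
    have near_c := near_pushoff_diagonal FF sK sW cK cW int (D0 t0) cs ct ce epos.
    by apply: (@filterS _ F FF _ _ _ near_c) => z /(_ i j) H /H; left.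
  have Kneq : K s0 <> K t0 by move=> /injK.
  have cc (X Y : R -> 'rV[R]_3) (u : (R * R) * R -> R) (u0 : R) b k :
      continuous X -> continuous Y -> u z @[z --> F] --> u0 ->
      pushoff X Y z.2 b (u z) 0 k @[z --> F] --> X u0 0 k.
    by move=> cX cY cu; apply: cvg_pushoff.
  have cont := smooth_continuous; have cont1 := smooth_continuous1.
  have [eqp|neqp] := pselect (proj (K s0) = proj (K t0)); last first.
    have near_n : \forall z \near F, proj (pushoff K W z.2 i z.1.1) <> proj (pushoff K W z.2 j z.1.2).
      apply: (near_proj_neq FF _ _ neqp) => k; apply: cc => //; exact: cont.
    by apply: (@filterS _ F FF _ _ _ near_n) => z neq /neq.
  have near_n : \forall z \near F, pushoff K W z.2 i z.1.1 <> pushoff K W z.2 j z.1.2.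
    by apply: (near_neq FF _ _ Kneq) => k; apply: cc => //; exact: cont.
  have near_d : \forall z \near F, det2 (proj (pushoff (derive1 K) (derive1 W) z.2 i z.1.1))
      (proj (pushoff (derive1 K) (derive1 W) z.2 j z.1.2)) != 0.
    have d0 : det2 (proj (derive1 K s0)) (proj (derive1 K t0)) != 0 by exact: trans tt tt _ _ eqp Kneq.
    have h1 k := cc _ _ (fun z => z.1.1) s0 i k (cont1 _ _ sK) (cont1 _ _ sW) cs.
    have h2 k := cc _ _ (fun z => z.1.2) t0 j k (cont1 _ _ sK) (cont1 _ _ sW) ct.
    apply: (cvgr_neq0 _ _ d0).
    by apply: cvg_det2; [exact: h1|exact: h1|exact: h2|exact: h2].
  near=> z => _; right; split; first by near: z.
  by rewrite !derive1_pushoff //; near: z.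
have := near_e; apply: filterS => e He s t i j eqp.
have [n sn] := unit_representative s; have [m tm] := unit_representative t.
have cL b := pushoff_closed e b cK cW.
have cL' b := closed_curve_derive1 (cL b).
have inI y (l : int) : 0 <= y - l%:~R < 1 -> I01 (y - l%:~R).
  by rewrite /I01 /= in_itv /= => /andP[-> /ltW ->].
have := He (s - n%:~R, t - m%:~R) (conj (inI _ _ sn) (inI _ _ tm)) i j.
rewrite /= !closed_curveB_int // => /(_ eqp) [[ij st]|]; last by right.
left; split => //.
have -> : s - t = s - n%:~R - (t - m%:~R) + (n - m)%:~R by rewrite intrD mulrNz; lra.
by rewrite rpredD // intr_int.
Unshelve. all: by end_near. Qed.

Lemma near_pushoff_immersed (R : realType) (K W : R -> 'rV[R]_3) :
  knot_diagram K -> smooth W -> closed_curve W ->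
  \forall e \near (0 : R)^'+, forall t b, proj (derive1 (pushoff K W e b) t) <> (0, 0).
Proof.
move=> [[Kknot _] imm _ _ _] sW cW; have {Kknot}[cK sK _ _] := Kknot tt.
have proj0 : proj (0 : 'rV[R]_3) = (0, 0) by rewrite /proj /xcoord /ycoord !mxE.
have near_e : \forall e \near (0 : R)^'+, forall t, `[0, 1]%classic t -> forall b,
    proj (derive1 (pushoff K W e b) t) <> (0, 0).
  have /compact_near_coveringP cI := @segment_compact R 0 1.
  apply: (cI _ (0 : R)^'+ (fun e t => forall b, _ <> _)) => t0 _.
  pose F := filter_prod (nbhs t0) (0 : R)^'+.
  have FF : Filter F by exact: filter_prod_filter.
  have ct : z.1 @[z --> F] --> t0 by exact: cvg_fst.
  have ce : z.2 @[z --> F] --> (0 : R).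
    apply: (@cvg_trans _ (id x @[x --> (0 : R)^'+])); first exact: cvg_snd.
    by apply: cvg_at_right_filter; exact: cvg_id.
  have near_z : \forall z \near F, forall b, proj (derive1 (pushoff K W z.2 b) z.1) <> (0, 0).
    apply: near_bool_all => b.
    have imm0 : proj (derive1 K t0) <> proj (0 : 'rV[R]_3) by rewrite proj0; exact: (imm tt).
    have near_n : \forall z \near F, proj (pushoff (derive1 K) (derive1 W) z.2 b z.1)
        <> proj (0 : 'rV[R]_3).
      apply: (near_proj_neq FF _ _ imm0) => k; last exact: cvg_cst.
      by apply: cvg_pushoff => //; exact: smooth_continuous1.
    by apply: (@filterS _ F FF _ _ _ near_n) => z; rewrite proj0 derive1_pushoff.
  exact: near_z.
apply: filterS near_e => e He t b.
have [n tn] := unit_representative t.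
rewrite -(@closed_curveB_int _ _ t n); last exact/closed_curve_derive1/pushoff_closed.
by apply: He; rewrite /= in_itv /=; move/andP: tn => [-> /ltW ->].
Qed.

(** If two of the limit parameters agree modulo 1, a coincidence of projections near them is an
    equality in space. Otherwise [K] takes three distinct values there, and as its diagram has no
    triple point two of the projections differ, which persists for small [e]. *)
Lemma near_pushoff_double (R : realType) (K W : R -> 'rV[R]_3) :
  knot_diagram K -> smooth W -> closed_curve W ->
  (forall t, det2 (proj (derive1 K t)) (proj (W t)) != 0) ->
  \forall e \near (0 : R)^'+, forall r s t i j k,
    proj (pushoff K W e i r) = proj (pushoff K W e j s) ->
    proj (pushoff K W e j s) = proj (pushoff K W e k t) ->
    [\/ pushoff K W e i r = pushoff K W e j s, pushoff K W e j s = pushoff K W e k t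
      | pushoff K W e i r = pushoff K W e k t].
Proof.
move=> [[Kknot _] _ _ dbl _] sW cW D0; have {Kknot}[cK sK _ injK] := Kknot tt.
pose I01 : set R := `[0, 1]%classic.
pose Q e i j k (p : R * R * R) :=
  proj (pushoff K W e i p.1.1) = proj (pushoff K W e j p.1.2) ->
  proj (pushoff K W e j p.1.2) = proj (pushoff K W e k p.2) ->
  [\/ pushoff K W e i p.1.1 = pushoff K W e j p.1.2,
      pushoff K W e j p.1.2 = pushoff K W e k p.2
    | pushoff K W e i p.1.1 = pushoff K W e k p.2].
have near_e : \forall e \near (0 : R)^'+, forall p, (I01 `*` I01 `*` I01) p ->
    forall i j k, Q e i j k p.
  have /compact_near_coveringP cI : compact (I01 `*` I01 `*` I01).
    by apply: compact_setX; [apply: compact_setX|]; exact: segment_compact.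
  apply: (cI _ (0 : R)^'+ (fun e p => forall i j k, Q e i j k p)) => -[[r0 s0] t0] _.
  pose F := filter_prod (nbhs (r0, s0, t0)) (0 : R)^'+.
  have FF : Filter F by exact: filter_prod_filter.
  have c1 : z.1.1 @[z --> F] --> (r0, s0).
    apply: (@cvg_comp _ _ _ fst fst _ (nbhs (r0, s0, t0))); first exact: cvg_fst.
    by apply: (@cvg_fst _ _ (nbhs (r0, s0)) (nbhs t0)).
  have cr : z.1.1.1 @[z --> F] --> r0.
    apply: (@cvg_comp _ _ _ (fun z => z.1.1) fst _ (nbhs (r0, s0))); first exact: c1.
    by apply: (@cvg_fst _ _ (nbhs r0) (nbhs s0)).
  have cs : z.1.1.2 @[z --> F] --> s0.
    apply: (@cvg_comp _ _ _ (fun z => z.1.1) snd _ (nbhs (r0, s0))); first exact: c1.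
    by apply: (@cvg_snd _ _ (nbhs r0) (nbhs s0)).
  have ct : z.1.2 @[z --> F] --> t0.
    apply: (@cvg_comp _ _ _ fst snd _ (nbhs (r0, s0, t0))); first exact: cvg_fst.
    by apply: (@cvg_snd _ _ (nbhs (r0, s0)) (nbhs t0)).
  have ce : z.2 @[z --> F] --> (0 : R).
    apply: (@cvg_trans _ (id x @[x --> (0 : R)^'+])); first exact: cvg_snd.
    by apply: cvg_at_right_filter; exact: cvg_id.
  have epos : \forall z \near F, 0 < z.2.
    exists (setT, [set e : R | 0 < e]); last by move=> [? ?] [].
    by split; [exact: filterT|exact: nbhs_right_gt].
  have near_diag (u v : (R * R * R) * R -> R) u0 v0 : u z @[z --> F] --> u0 ->
      v z @[z --> F] --> v0 -> u0 - v0 \is a Num.int ->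
      \forall z \near F, forall i j,
        proj (pushoff K W z.2 i (u z)) = proj (pushoff K W z.2 j (v z)) ->
        pushoff K W z.2 i (u z) = pushoff K W z.2 j (v z).
    move=> cu cv int.
    have near_c := near_pushoff_diagonal FF sK sW cK cW int (D0 v0) cu cv ce epos.
    apply: (@filterS _ F FF _ _ _ near_c) => z H i j /H[-> uv].
    by apply: closed_curve_modn uv; exact: pushoff_closed.
  suff nearQ : \forall z \near F, forall i j k, Q z.2 i j k z.1 by exact: nearQ.
  have [int|rs] := pselect (r0 - s0 \is a Num.int).
    apply: (@filterS _ F FF _ _ _ (near_diag _ _ _ _ cr cs int)) => z H i j k e1 e2.
    by constructor 1; exact: H.
  have [int|st] := pselect (s0 - t0 \is a Num.int).
    apply: (@filterS _ F FF _ _ _ (near_diag _ _ _ _ cs ct int)) => z H i j k e1 e2.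
    by constructor 2; exact: H.
  have [int|rt] := pselect (r0 - t0 \is a Num.int).
    apply: (@filterS _ F FF _ _ _ (near_diag _ _ _ _ cr ct int)) => z H i j k e1 e2.
    by constructor 3; apply: H; rewrite e1.
  have near_sep (u v : (R * R * R) * R -> R) u0 v0 : u z @[z --> F] --> u0 ->
      v z @[z --> F] --> v0 -> proj (K u0) <> proj (K v0) ->
      \forall z \near F, forall i j,
        proj (pushoff K W z.2 i (u z)) <> proj (pushoff K W z.2 j (v z)).
    move=> cu cv neq; apply: near_bool_all => i; apply: near_bool_all => j.
    by apply: (near_proj_neq FF _ _ neq) => l; apply: cvg_pushoff => //; exact: smooth_continuous.
  have [ers|nrs] := pselect (proj (K r0) = proj (K s0)); last first.
    apply: (@filterS _ F FF _ _ _ (near_sep _ _ _ _ cr cs nrs)) => z H i j k e1.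
    by case: (H i j).
  have [est|nst] := pselect (proj (K s0) = proj (K t0)); last first.
    apply: (@filterS _ F FF _ _ _ (near_sep _ _ _ _ cs ct nst)) => z H i j k _ e2.
    by case: (H j k).
  by have [/injK|/injK|/injK] := dbl tt tt tt r0 s0 t0 ers est.
apply: filterS near_e => e He r s t i j k.
have [l rl] := unit_representative r.
have [n sn] := unit_representative s; have [m tm] := unit_representative t.
have cL b := pushoff_closed e b cK cW.
have inI y (q : int) : 0 <= y - q%:~R < 1 -> I01 (y - q%:~R).
  by rewrite /I01 /= in_itv /= => /andP[-> /ltW ->].
have := He (r - l%:~R, s - n%:~R, t - m%:~R) 
  (conj (conj (inI _ _ rl) (inI _ _ sn)) (inI _ _ tm)) i j k.
by rewrite /Q /= !closed_curveB_int.
Qed.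

Lemma pushoff_diagram (R : realType) (K W : R -> 'rV[R]_3) (e : R) :
  smooth K -> closed_curve K -> smooth W -> closed_curve W ->
  (forall t b, proj (derive1 (pushoff K W e b) t) <> (0, 0)) ->
  (forall s t i j,
    proj (pushoff K W e i s) = proj (pushoff K W e j t) ->
    (i = j /\ s - t \is a Num.int) \/
    (pushoff K W e i s <> pushoff K W e j t /\
     planar_det (derive1 (pushoff K W e i) s) (derive1 (pushoff K W e j) t) != 0)) ->
  (forall r s t i j k,
    proj (pushoff K W e i r) = proj (pushoff K W e j s) ->
    proj (pushoff K W e j s) = proj (pushoff K W e k t) ->
    [\/ pushoff K W e i r = pushoff K W e j s, pushoff K W e j s = pushoff K W e k t
      | pushoff K W e i r = pushoff K W e k t]) ->
  is_diagram (pushoff K W e).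
Proof.
move=> sK cK sW cW imm cross dbl.
have sL b := @pushoff_smooth _ K W e b sK sW; have cL b := pushoff_closed e b cK cW.
(* Points equal in space have equal projections, and only the first outcome of [cross] is then
   possible. *)
have injL i j s t : pushoff K W e i s = pushoff K W e j t -> i = j /\ s - t \is a Num.int.
  by move=> eL; have [//|[]] := cross s t i j (congr1 _ eL).
have trans i j s t : proj (pushoff K W e i s) = proj (pushoff K W e j t) ->
    pushoff K W e i s <> pushoff K W e j t ->
    planar_det (derive1 (pushoff K W e i) s) (derive1 (pushoff K W e j) t) != 0.
  move=> eqp neq; have [[ij st]|[]//] := cross s t i j eqp.
  by case: neq; rewrite ij; exact: closed_curve_modn st.
split.
- split=> [b|i j s t ij eL]; last by case: ij; have [] := injL _ _ _ _ eL.
  split; [exact: cL|exact: sL| |by move=> s t eL; have [] := injL _ _ _ _ eL].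
  move=> t; apply/eqP => d0; apply: (imm t b).
  by rewrite d0 /proj /xcoord /ycoord !mxE.
- by move=> b t; exact: imm.
- by move=> i j s t; exact: trans.
- by move=> i j k r s t; exact: dbl.
(* Where the curves meet in space they are one component at one parameter modulo 1, and its immersed
   projection is injective nearby. *)
move=> i j; apply: finite_crossings; [exact: sL|exact: sL|by move=> s t; exact: trans|].
move=> s t eL; have [<- st] := injL _ _ _ _ eL.
have cs : p.1 @[p --> (s, t)] --> s by apply: (@cvg_fst _ _ (nbhs s) (nbhs t)).
have ct : p.2 @[p --> (s, t)] --> t by apply: (@cvg_snd _ _ (nbhs s) (nbhs t)).
have FF : Filter (nbhs (s, t)) by exact: nbhs_filter.
have near_c := near_immersion_inj FF (sL i) (cL i) (imm t i) st cs ct.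
apply: (@filterS _ _ FF _ _ _ near_c) => p H /H pst.
by apply: (closed_curve_modn (cL i)); rewrite pst.
Qed.

(** * Degrees of push-offs and of diagrams, and the linking number *)

Lemma proj_subr_eq0 (R : realType) (u v : 'rV[R]_3) : proj (u - v) = (0, 0) -> proj u = proj v.
Proof.
rewrite /proj /xcoord /ycoord !mxE => -[/eqP + /eqP].
by rewrite !subr_eq0 => /eqP -> /eqP ->.
Qed.

Lemma continuous_difference (R : realType) (A B : R -> 'rV[R]_3) :
  continuous A -> continuous B -> continuous (fun q : R * R => A q.1 - B q.2).
Proof.
move=> cA cB [s t]; apply: cvgB; apply: cvg_comp_continuous => //.
  by apply: (@cvg_fst _ _ (nbhs s) (nbhs t)).
by apply: (@cvg_snd _ _ (nbhs s) (nbhs t)).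
Qed.

(** [degree_near_diagram] is used with [A = B = K], so that the translation [x] depends on [K] alone
    and is fixed before [e] is taken small. Since [i != j], the projection has no zero near the
    diagonal, nor near the two corners of the window where the parameters differ by 1. *)
Lemma near_pushoff_degree (R : realType) (K W : R -> 'rV[R]_3) (i j : bool) :
  i != j -> knot_diagram K -> smooth W -> closed_curve W ->
  (forall t, det2 (proj (derive1 K t)) (proj (W t)) != 0) ->
  exists x : R, \forall e \near (0 : R)^'+, \forall N \near \oo,
    degree N (fun s t => pushoff K W e i (s - x) - pushoff K W e j (t - x)) = - writhe K.
Proof.
move=> ij [[Kknot _] imm trans _ fin] sW cW D0; have {Kknot}[cK sK _ injK] := Kknot tt.
have fS : finite_set (double_points K K) by apply: finite_double_points; exact: (fin tt tt).
have [x [d [k [x0 d0 k0 Sx H]]]] := degree_near_diagram sK sK fS (trans tt tt).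
exists x; pose I : set R := `[- x, 1 - x]%classic.
pose Q e (p : R * R) :=
  (forall l, `|(pushoff K W e i p.1 - pushoff K W e j p.2) 0 l - (K p.1 - K p.2) 0 l| < k) /\
  ((forall q, double_points K K q -> ~ (`|p.1 - q.1| < d /\ `|p.2 - q.2| < d)) ->
    proj (pushoff K W e i p.1) <> proj (pushoff K W e j p.2)).
have near_e : \forall e \near (0 : R)^'+, forall p, (I `*` I) p -> Q e p.
  have /compact_near_coveringP cI : compact (I `*` I).
    by apply: compact_setX; exact: segment_compact.
  apply: (cI _ (0 : R)^'+ Q) => -[s0 t0] [/= Is It].
  pose F := filter_prod (nbhs (s0, t0)) (0 : R)^'+.
  have FF : Filter F by exact: filter_prod_filter.
  have cs : z.1.1 @[z --> F] --> s0.
    apply: (@cvg_comp _ _ _ fst fst _ (nbhs (s0, t0))); first exact: cvg_fst.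
    by apply: (@cvg_fst _ _ (nbhs s0) (nbhs t0)).
  have ct : z.1.2 @[z --> F] --> t0.
    apply: (@cvg_comp _ _ _ fst snd _ (nbhs (s0, t0))); first exact: cvg_fst.
    by apply: (@cvg_snd _ _ (nbhs s0) (nbhs t0)).
  have ce : z.2 @[z --> F] --> (0 : R).
    apply: (@cvg_trans _ (id x @[x --> (0 : R)^'+])); first exact: cvg_snd.
    by apply: cvg_at_right_filter; exact: cvg_id.
  have epos : \forall z \near F, 0 < z.2.
    exists (setT, [set e : R | 0 < e]); last by move=> [? ?] [].
    by split; [exact: filterT|exact: nbhs_right_gt].
  have cont := smooth_continuous.
  have cL1 l : pushoff K W z.2 i z.1.1 0 l @[z --> F] --> K s0 0 l.
    by apply: cvg_pushoff => //; exact: cont.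
  have cL2 l : pushoff K W z.2 j z.1.2 0 l @[z --> F] --> K t0 0 l.
    by apply: cvg_pushoff => //; exact: cont.
  have close l : \forall z \near F,
      `|(pushoff K W z.2 i z.1.1 - pushoff K W z.2 j z.1.2) 0 l - (K z.1.1 - K z.1.2) 0 l| < k.
    have c0 : (pushoff K W z.2 i z.1.1 0 l - pushoff K W z.2 j z.1.2 0 l)
        - (K z.1.1 0 l - K z.1.2 0 l) @[z --> F]
        --> (K s0 0 l - K t0 0 l) - (K s0 0 l - K t0 0 l).
      by apply: cvgB; apply: cvgB => //; apply: cvg_curve => //; exact: cont.
    rewrite subrr in c0.
    have subE (u v : 'rV[R]_3) : (u - v) 0 l = u 0 l - v 0 l by rewrite !mxE.
    near=> z; rewrite !subE; near: z; exact: cvgr0_norm_lt c0 _ k0.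
  suff nearQ : \forall z \near F, Q z.2 z.1 by exact: nearQ.
  have close_all : \forall z \near F, forall l, l \in enum 'I_3 ->
      `|(pushoff K W z.2 i z.1.1 - pushoff K W z.2 j z.1.2) 0 l - (K z.1.1 - K z.1.2) 0 l| < k.
    by apply: near_seq_all => l _; exact: close.
  suff near_n : \forall z \near F,
      (forall q, double_points K K q -> ~ (`|z.1.1 - q.1| < d /\ `|z.1.2 - q.2| < d)) ->
      proj (pushoff K W z.2 i z.1.1) <> proj (pushoff K W z.2 j z.1.2).
    apply: (@filterS2 _ F FF _ _ _ _ close_all near_n) => z h1 h2.
    by split=> // l; apply: h1; rewrite mem_enum.
  have [int|nint] := pselect (s0 - t0 \is a Num.int).
    have near_c := near_pushoff_diagonal FF sK sW cK cW int (D0 t0) cs ct ce epos.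
    by apply: (@filterS _ F FF _ _ _ near_c) => z h _ /h[e_ij]; rewrite e_ij eqxx in ij.
  have Kneq : K s0 <> K t0 by move=> /injK.
  have [eqp|neqp] := pselect (proj (K s0) = proj (K t0)); last first.
    have near_n := near_proj_neq FF cL1 cL2 neqp.
    by apply: (@filterS _ F FF _ _ _ near_n) => z h _.
  have S0 : double_points K K (s0, t0).
    by apply: (double_points_window cK cK Sx x0).
  have near_s : \forall z \near F, `|z.1.1 - s0| < d.
    by move/cvgrPdistC_lt : cs; apply.
  have near_t : \forall z \near F, `|z.1.2 - t0| < d.
    by move/cvgrPdistC_lt : ct; apply.
  apply: (@filterS2 _ F FF _ _ _ _ near_s near_t) => z h1 h2 h.
  by case: (h _ S0).
apply: filterS near_e => e He.
apply: (H (fun s t => pushoff K W e i s - pushoff K W e j t)).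
- by apply: continuous_difference; apply: smooth_continuous; exact: pushoff_smooth.
- move=> s t l Is It; have [|+ _] := He (s, t); last exact.
  by split; rewrite /I /= in_itv.
move=> s t Is It nb /proj_subr_eq0; have [|_] := He (s, t); last exact.
by split; rewrite /I /= in_itv.
Unshelve. all: by end_near. Qed.

(** Here the exact difference is an admissible [G]: the components are disjoint, so every zero of
    its projection is a double point, the centre of an excluded square. *)
Lemma degree_diagram (R : realType) (J : bool -> R -> 'rV[R]_3) (i j : bool) :
  i != j -> is_diagram J ->
  exists x : R, \forall N \near \oo,
    degree N (fun s t => J i (s - x) - J j (t - x)) = - sign_sum (J i) (J j).
Proof.
move=> ij [[Jknot Jdisj] _ trans _ fin].
have [ci si _ _] := Jknot i; have [cj sj _ _] := Jknot j.
have fS := finite_double_points (fin i j) (fin j i).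
have [x [d [k [x0 d0 k0 Sx H]]]] := degree_near_diagram si sj fS (trans i j).
exists x; apply: (H (fun s t => J i s - J j t)).
- by apply: continuous_difference; exact: smooth_continuous.
- by move=> s t l _ _; rewrite subrr normr0.
move=> s t Is It nb /proj_subr_eq0 eqp.
have neq : J i s <> J j t by apply: Jdisj; apply/eqP.
have := nb _ (double_points_window ci cj Sx x0 Is It eqp neq).
by rewrite /= !subrr normr0; case.
Qed.

Lemma ambient_isotopic_refl (R : realType) (I : Type) (L : I -> R -> 'rV[R]_3) :
  ambient_isotopic L L.
Proof.
exists snd; split=> //; first by move=> [r v]; apply: (@cvg_snd _ _ (nbhs r) (nbhs v)).
by move=> r; split=> [v|]; [exact: cvg_id|exists id => // v; exact: cvg_id].
Qed.

(** Each equality of degrees holds only for large [N]; one [N] common to the three of them is enough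
    to compare the integers. *)
Lemma sign_sum_isotopic (R : realType) (L J : bool -> R -> 'rV[R]_3) (i j : bool) (x : R)
    (w : int) :
  i != j -> is_link L -> is_diagram J -> ambient_isotopic L J ->
  (\forall N \near \oo, degree N (fun s t => L i (s - x) - L j (t - x)) = - w) ->
  sign_sum (J i) (J j) = w.
Proof.
move=> ij [Lknot Ldisj] dJ iso near_w.
have [c1 s1 _ _] := Lknot i; have [c2 s2 _ _] := Lknot j.
have [y near_y] := degree_diagram ij dJ.
have Lij s t : L i s <> L j t by apply: Ldisj; apply/eqP.
have near_iso := degree_isotopic x y c1 c2 (smooth_continuous s1) (smooth_continuous s2) Lij iso.
have [N [h1 [h2 h3]]] := filter_ex (filterI near_w (filterI near_y near_iso)).
by move: h3; rewrite h1 h2 => /oppr_inj.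
Qed.

Theorem proposition3p9 (R : realType) (K V : R -> 'rV[R]_3)
    (hD : knot_diagram K) (hV : blackboard_framing K V) :
  self_linking_number K V (writhe K)%:~R.
Proof.
have [d d0 Hd] := near_framing_transverse hD hV.
exists d => // W cW sW WV; have D0 := Hd W WV.
have [[Kknot _] _ _ _ _] := hD; have [cK sK _ _] := Kknot tt.
have [x near_x] := @near_pushoff_degree _ K W true false isT hD sW cW D0.
have [y near_y] := @near_pushoff_degree _ K W false true isT hD sW cW D0.
near=> e.
have dL : is_diagram (pushoff K W e).
  apply: pushoff_diagram => //.
  - by near: e; exact: near_pushoff_immersed.
  - by near: e; exact: near_pushoff_crossing.
  - by near: e; exact: near_pushoff_double.
have link := diagram_link dL; rewrite pair_link_shift; split=> //.
(* All diagrams of the pair yield this value, so the arbitrary choice made by [xget] is harmless. *)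
have value n : linking_value K (Defs.shift K W e) n -> n = (writhe K)%:~R.
  move=> [J1 [J2 []]]; rewrite pair_link_shift => iso dJ ->.
  have -> : sign_sum J1 J2 = writhe K.
    apply: (@sign_sum_isotopic _ _ _ true false x _ isT link dJ iso).
    by near: e; exact: near_x.
  have -> : sign_sum J2 J1 = writhe K.
    apply: (@sign_sum_isotopic _ _ _ false true y _ isT link dJ iso).
    by near: e; exact: near_y.
  by rewrite intrD; lra.
apply: value; apply: (@xgetPex _ 0 [set n | linking_value K (Defs.shift K W e) n]).
eexists; exists K, (Defs.shift K W e); split; last reflexivity.
  exact: ambient_isotopic_refl.
by rewrite pair_link_shift.
Unshelve. all: by end_near. Qed.
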